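(* For an integer $r\ge1$ let $T_r=C_5^{\square r}$ be the Cartesian product of $r$ copies of the five-cycle $C_5$. Then: (i) $T_r$ has $5^r$ vertices, and every vertex has degree $2r$; (ii) every edge of $T_r$ has Lin--Lu--Yau curvature $1/(2r)$; (iii) for every field $\mathbb F$, \[ H^{\mathrm{GLMY}}_p(T_r;\mathbb F)\cong \begin{cases} \mathbb F^{\binom rp},&0\le p\le r,\\ 0,&p>r. \end{cases} \]
   Context: Graphs are undirected and simple; $x\sim y$ denotes adjacency, $d$ is the graph distance, $d_x$ is the degree of $x$. **Cartesian product.** $G\square H$ has vertex set $V(G)\times V(H)$, with $(g,h)\sim(g',h')$ when either $g=g'$ and $\{h,h'\}\in E(H)$, or $h=h'$ and $\{g,g'\}\in E(G)$. **Lin--Lu--Yau curvature.** Let $G=(V,E)$ be a connected locally finite graph. For a vertex $x$ of positive degree and $\alpha\in[0,1]$ let $\mu_x^\alpha$ be the probability measure on $V$ with $\mu_x^\alpha(x)=\alpha$, $\mu_x^\alpha(z)=(1-\alpha)/d_x$ for $z\sim x$, and $\mu_x^\alpha(z)=0$ otherwise. For finitely supported probability measures $\mu,\nu$ on $V$, $W_1(\mu,\nu)=\inf_\pi\sum_{u,v}d(u,v)\pi(u,v)$, the infimum being over all couplings $\pi:V\times V\to[0,\infty)$ of $\mu$ and $\nu$. For distinct $x,y$ put $\kappa_\alpha(x,y)=1-W_1(\mu_x^\alpha,\mu_y^\alpha)/d(x,y)$; the Lin--Lu--Yau curvature is $\kappa(x,y)=\lim_{\alpha\to1^-}\kappa_\alpha(x,y)/(1-\alpha)$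 (the limit is known to exist). The curvature of an edge $\{x,y\}$ is $\kappa(x,y)$. **GLMY path homology.** Let $\mathbb F$ be a field and $V$ a finite set. An elementary $p$-path is a symbol $e_{i_0\ldots i_p}$ with $i_0,\dots,i_p\in V$; it is regular if $i_{q-1}\ne i_q$ for $1\le q\le p$. Let $\mathcal R_p(V;\mathbb F)$ be the $\mathbb F$-vector space spanned by elementary $p$-paths modulo those that are not regular, with boundary $\partial e_{i_0\ldots i_p}=\sum_{q=0}^p(-1)^q e_{i_0\ldots\widehat{i_q}\ldots i_p}$, nonregular terms being set to zero, and $\partial=0$ on $0$-paths. For a finite digraph $D=(V,E_D)$, a regular elementary path $e_{i_0\ldots i_p}$ is allowed if $(i_{q-1},i_q)\in E_D$ for $1\le q\le p$; $\mathcal A_p(D;\mathbb F)\subseteq\mathcal R_p(V;\mathbb F)$ is the span of the allowed elementary $p$-paths, and $\Omega_p(D;\mathbb F)=\{u\in\mathcal A_p(D;\mathbb F):\partial u\in\mathcal A_{p-1}(D;\mathbb F)\}$ (with $\Omega_0=\mathcal A_0$). Then $\partial\Omega_p\subseteq\Omega_{p-1}$, and $H^{\mathrm{GLMY}}_p(D;\mathbb F)=\ker(\partial|_{\Omega_p})/\partial(\Omega_{p+1})$. For an undirected finite graph $G$, $H^{\mathrm{GLMY}}_p(G;\mathbb F)$ is defined as $H^{\mathrm{GLMY}}_p$ of the digraph obtained by replacing each edge $\{x,y\}$ by the two directed edges $(x,y)$ and $(y,x)$. *)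

(* Defs.v *)
From HB Require Import structures.
From mathcomp Require Import all_boot all_order all_algebra.
From mathcomp Require Import all_classical all_reals all_analysis.

Set Implicit Arguments.
Unset Strict Implicit.
Unset Printing Implicit Defensive.

Import Order.TTheory GRing.Theory Num.Theory.
Import numFieldNormedType.Exports.

Local Open Scope ring_scope.
Local Open Scope classical_set_scope.

Record sgraph := SGraph {
  vertex :> finType;
  adj : rel vertex;
  adj_sym : symmetric adj;
  adj_irr : irreflexive adj }.

Definition degree (G : sgraph) (x : G) : nat := #|[pred z | adj x z]|.

Definition cart_adj (G H : sgraph) : rel (G * H) :=
  fun u v => (u.1 == v.1) && adj u.2 v.2 || (u.2 == v.2) && adj u.1 v.1.

Lemma cart_adj_sym (G H : sgraph) : symmetric (@cart_adj G H).
Proof.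
move=> u v; rewrite /cart_adj (eq_sym u.1) (eq_sym u.2).
by rewrite (adj_sym u.1) (adj_sym u.2).
Qed.

Lemma cart_adj_irr (G H : sgraph) : irreflexive (@cart_adj G H).
Proof. by move=> u; rewrite /cart_adj !adj_irr !andbF. Qed.

Definition cart_prod (G H : sgraph) : sgraph :=
  SGraph (@cart_adj_sym G H) (@cart_adj_irr G H).

Definition C5_adj : rel 'I_5 := fun i j => (j == ordS i) || (i == ordS j).

Lemma C5_adj_sym : symmetric C5_adj.
Proof. by move=> i j; rewrite /C5_adj orbC. Qed.

Lemma C5_adj_irr : irreflexive C5_adj.
Proof. by case=> -[|[|[|[|[|//]]]]] i. Qed.

Definition C5 : sgraph := SGraph C5_adj_sym C5_adj_irr.

Lemma K1_adj_sym : symmetric (fun _ _ : unit => false).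
Proof. by []. Qed.

Lemma K1_adj_irr : irreflexive (fun _ _ : unit => false).
Proof. by []. Qed.

Definition K1 : sgraph := SGraph K1_adj_sym K1_adj_irr.

(* [cart_power G 1] is [G] itself, [cart_power G r.+2] is
   [cart_prod G (cart_power G r.+1)]; the empty product is a point. *)
Definition cart_power (G : sgraph) (r : nat) : sgraph :=
  iterop r cart_prod G K1.

(* A shortest walk has fewer than #|G| edges, so this is the graph distance
   whenever [x] and [y] are connected; otherwise it takes the value #|G|. *)
Definition gdist (G : sgraph) (x y : G) : nat :=
  find (fun n => [exists p : n.-tuple G, path (@adj G) x p && (last x p == y)])
       (iota 0 #|G|).

Section Curvature.
Variables (R : realType) (G : sgraph).

Definition lazy_measure (a : R) (x : G) : G -> R := fun z =>
  if z == x then a else if adj x z then (1 - a) / (degree x)%:R else 0.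

Definition coupling (mu nu : G -> R) : set (G -> G -> R) :=
  [set pi | [/\ forall u v, 0 <= pi u v,
               forall u, \sum_v pi u v = mu u &
               forall v, \sum_u pi u v = nu v]].

Definition transport_cost (pi : G -> G -> R) : R :=
  \sum_u \sum_v (gdist u v)%:R * pi u v.

Definition W1 (mu nu : G -> R) : R :=
  inf [set transport_cost pi | pi in coupling mu nu].

Definition kappa (a : R) (x y : G) : R :=
  1 - W1 (lazy_measure a x) (lazy_measure a y) / (gdist x y)%:R.

(* Convergence rather than an equation on [lim], which is total and takes a
   default value when there is no limit. *)
Definition has_LLY_curvature (x y : G) (k : R) : Prop :=
  kappa a x y / (1 - a) @[a --> 1^'-] --> k.

End Curvature.

(* The quotient of [Z] by its subspace of vectors lying in [B]; it is Z/B as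
   soon as B is contained in Z. The library has quotient groups of a zmodType;
   scalar multiplication is added here. *)
Section VectorQuotient.
Variables (F : fieldType) (vT : vectType F) (Z B : {vspace vT}).
Local Open Scope quotient_scope.

Definition quotv_pred : {pred subvs_of Z} := [pred u | vsval u \in B].

Lemma quotv_zmod_closed : zmod_closed quotv_pred.
Proof.
by split=> [|u v]; rewrite !inE ?raddf0 ?mem0v // raddfB; exact: memvB.
Qed.

HB.instance Definition _ :=
  GRing.isZmodClosed.Build (subvs_of Z) quotv_pred quotv_zmod_closed.

Definition quotv := Quotient.quot quotv_pred.

HB.instance Definition _ := GRing.Zmodule.on quotv.
HB.instance Definition _ := Quotient.on quotv.

Definition quotv_scale (c : F) (h : quotv) : quotv := \pi_quotv (c *: repr h).

Lemma pi_quotv_scale c (u : subvs_of Z) :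
  quotv_scale c (\pi_quotv u) = \pi_quotv (c *: u).
Proof.
apply/eqP; rewrite -Quotient.idealrBE -scalerBr inE linearZ /= memvZ //.
have : repr (\pi_quotv u) - u \in quotv_pred by rewrite Quotient.idealrBE reprK.
by rewrite inE.
Qed.

Lemma pi_quotvD (u v : subvs_of Z) :
  \pi_quotv (u + v) = \pi_quotv u + \pi_quotv v.
Proof. exact: (raddfD \pi_(Quotient.quot quotv_pred)). Qed.

Lemma quotv_scaleA a b h :
  quotv_scale a (quotv_scale b h) = quotv_scale (a * b) h.
Proof. by rewrite -[h]reprK (pi_quotv_scale b) !pi_quotv_scale scalerA. Qed.

Lemma quotv_scale1 : left_id 1 quotv_scale.
Proof. by move=> h; rewrite -[h]reprK pi_quotv_scale scale1r. Qed.

Lemma quotv_scaleDr : right_distributive quotv_scale +%R.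
Proof.
move=> a g h; rewrite -[g]reprK -[h]reprK.
by rewrite -pi_quotvD !pi_quotv_scale scalerDr pi_quotvD.
Qed.

Lemma quotv_scaleDl h : {morph quotv_scale^~ h : a b / a + b}.
Proof.
by move=> a b; rewrite -[h]reprK !pi_quotv_scale scalerDl pi_quotvD.
Qed.

HB.instance Definition _ := GRing.Zmodule_isLmodule.Build F quotv
  quotv_scaleA quotv_scale1 quotv_scaleDr quotv_scaleDl.

End VectorQuotient.

Definition lmod_iso (F : fieldType) (U V : lmodType F) : Prop :=
  exists f : {linear U -> V}, bijective f.

Section PathHomology.
Variables (F : fieldType) (V : finType).

Definition regular (s : seq V) : bool := sorted (fun i j => i != j) s.

Definition rpath (p : nat) : Type := {t : p.+1.-tuple V | regular t}.

HB.instance Definition _ p := SubFinite.on (rpath p).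

(* The space of elementary p-paths modulo the nonregular ones has the classes
   of the regular ones as a basis; its elements are given by coordinates. *)
Definition rchain (p : nat) : Type := {ffun rpath p -> F^o}.

HB.instance Definition _ p := Vector.on (rchain p).

(* The class of e_t; it is 0 when t is not regular. *)
Definition elem (p : nat) (t : p.+1.-tuple V) : rchain p :=
  [ffun s : rpath p => (val s == t)%:R : F^o].

Definition face (p : nat) (t : p.+2.-tuple V) (q : 'I_p.+2) : p.+1.-tuple V :=
  [tuple tnth t (lift q j) | j < p.+1].

Definition bdS_fun (p : nat) (u : rchain p.+1) : rchain p :=
  \sum_(s : rpath p.+1)
    (u s : F) *: \sum_(q < p.+2) (-1) ^+ q *: elem (face (val s) q).

Lemma bdS_fun_is_linear p : linear (@bdS_fun p).
Proof.
move=> a u v; rewrite /bdS_fun scaler_sumr -big_split /=.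
by apply: eq_bigr => s _; rewrite !ffunE scalerDl scalerA.
Qed.

HB.instance Definition _ p := GRing.isLinear.Build F (rchain p.+1) (rchain p) _
  (@bdS_fun p) (@bdS_fun_is_linear p).

(* The boundary operator on p-chains; degree 0 maps to 0, and p.-1 for p = 0
   is a dummy target. *)
Definition bd (p : nat) : 'Hom(rchain p, rchain p.-1) :=
  match p with
  | 0 => 0
  | p'.+1 => linfun (@bdS_fun p')
  end.

Variable E : rel V.

Definition allowed_path (p : nat) : pred (rpath p) := fun s => sorted E (val s).

Definition allowed (p : nat) : {vspace rchain p} :=
  <<[seq elem (val s) | s in @allowed_path p]>>%VS.

(* For p = 0 the second condition is void since [bd 0] is zero. *)
Definition Omega (p : nat) : {vspace rchain p} :=
  (allowed p :&: bd p @^-1: allowed p.-1)%VS.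

Definition cycles (p : nat) : {vspace rchain p} := (Omega p :&: lker (bd p))%VS.

Definition boundaries (p : nat) : {vspace rchain p} := (bd p.+1 @: Omega p.+1)%VS.

Definition GLMY_homology (p : nat) : lmodType F :=
  quotv (cycles p) (boundaries p).

End PathHomology.

(* The digraph obtained from [G] by orienting each edge both ways has the
   symmetric relation [adj] as its set of arrows. *)
Definition GLMY_graph (F : fieldType) (G : sgraph) (p : nat) : lmodType F :=
  GLMY_homology F (@adj G) p.

(* Main.v *)
From HB Require Import structures.
From mathcomp Require Import all_boot all_order all_algebra.
From mathcomp Require Import all_classical all_reals all_analysis.
From mathcomp Require Import ring lra zify.
Require Import Defs.

Set Implicit Arguments.
Unset Strict Implicit.
Unset Printing Implicit Defensive.
Import Order.TTheory GRing.Theory Num.Theory.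
Import numFieldNormedType.Exports.
Local Open Scope ring_scope.

(** Vertices and degrees are counted factor by factor.

    For the curvature, an edge of the torus moves one coordinate by one step and
    lies on a pentagon x', x, y, y', o in that coordinate. Put d = 2r and
    m = (1 - a) / d. The measure at x is carried to the one at y by keeping m at x
    and at y, moving a - m from x to y, shifting each neighbour off the pentagon by
    one step, and sending x' to y' through o, at total cost 1 - m. The distance to
    x' in that coordinate is a 1-Lipschitz potential which increases by exactly the
    distance along each of these moves, so the coupling is optimal
    ([W1_potential]). Hence kappa_a = (1 - a) / d for all a near 1
    ([shift_curvature]).

    For the homology, chains are handled as functions on lists of vertices. A chain
    of a product graph that lies in Omega is determined by its values on the
    staircases with horizontal steps first, because exchanging a corner of a
    staircase changes the sign ([omega_corner]); this identifies Omega of the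
    product with the tensor product of the two complexes, and the boundary with the
    tensor differential ([omega_bicoef], [bdry_cross]). In C5, which has no
    triangles and no 4-cycles, Omega is spanned by the walks that go back and forth
    along one edge ([omega_C5_zigzag]). An explicit homotopy contracts this complex
    onto the span of one vertex and of the fundamental loop, both with zero
    differential ([contract_identity]). So the homology of the product of C5 and Y
    in degree p is that of Y in degree p plus that of Y in degree p - 1
    ([has_betti_C5_prod]), and Pascal's rule gives the binomial coefficients. No
    division occurs, so the field is arbitrary. *)

(** * The five-cycle *)

Lemma adj_neq (G : sgraph) (x y : G) : adj x y -> x != y.
Proof. by apply: contraTneq => ->; rewrite adj_irr. Qed.

Section FiveCycle.

Definition nxt (x : C5) : C5 := ordS x.
Definition prv (x : C5) : C5 := ord_pred x.
Definition o0 : C5 := @ord0 4.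
Definition o4 : C5 := @ord_max 4.

Lemma adj_C5E (x y : C5) : adj x y = (y == nxt x) || (x == nxt y).
Proof. by []. Qed.

Lemma prvK (x : C5) : nxt (prv x) = x.
Proof. exact: ord_predK. Qed.

Lemma nxtK (x : C5) : prv (nxt x) = x.
Proof. exact: ordSK. Qed.

Lemma adj_prv_nxt (x y : C5) : adj x y = (y == nxt x) || (y == prv x).
Proof.
by rewrite adj_C5E [x == _]eq_sym (can2_eq nxtK prvK).
Qed.

Lemma nxt_val (x : C5) : nat_of_ord (nxt x) = ((nat_of_ord x).+1 %% 5)%N.
Proof. by []. Qed.

Lemma adj_nxt (x : C5) : adj x (nxt x).
Proof. by rewrite adj_C5E eqxx. Qed.

Lemma adj_nxt2 (u v : C5) : adj (nxt u) (nxt v) = adj u v.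
Proof. by rewrite !adj_C5E !(can_eq nxtK). Qed.

(** The girth is five: adjacent ends would close a triangle, and a second common
    neighbour a 4-cycle. This reduces the path complex of [C5] to walks that go
    back and forth along one edge. *)
Lemma C5_two_steps (a b b' d : C5) : a != d -> adj a b -> adj b d ->
  ~~ adj a d /\ (adj a b' -> adj b' d -> b' = b).
Proof.
have E (u v : C5) : (u == v) = (nat_of_ord u == nat_of_ord v) by [].
rewrite !adj_C5E !E !nxt_val.
have Ha := ltn_ord a; have Hb := ltn_ord b; have Hd := ltn_ord d.
have Hb' := ltn_ord b'.
move: (nat_of_ord a) (nat_of_ord d) Ha Hd => i j Hi Hj ne ab bd.
split; first by lia.
by move=> ab' b'd; apply: val_inj => /=; lia.
Qed.

Variables (F : fieldType).

Lemma prv_neq_nxt (x : C5) : prv x != nxt x.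
Proof. by case: x => -[|[|[|[|[|]]]]]. Qed.

Lemma sum_nbrs (x : C5) (g : C5 -> F) : (forall v, ~~ adj x v -> g v = 0) ->
  \sum_v g v = g (prv x) + g (nxt x).
Proof.
move=> g0; rewrite (bigD1 (prv x)) //= (bigD1 (nxt x)) /=; last first.
  by rewrite eq_sym prv_neq_nxt.
rewrite big1 ?addr0 // => v /andP[vp vn]; apply: g0.
by rewrite adj_prv_nxt (negbTE vp) (negbTE vn).
Qed.

Lemma eq_C5 (u v : C5) : (u == v) = (nat_of_ord u == nat_of_ord v)%N.
Proof. by []. Qed.

(** Cutting the edge between [o4] and [o0] turns the cycle into a path, along
    which the tails [x < v] decrease by one vertex at each step. At [o0] the
    previous vertex is [o4], whose tail is empty, hence the correction. *)
Lemma cut_diff (g : C5 -> F) (x : C5) :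
  \sum_(v : C5 | (prv x < v)%N) g v - \sum_(v : C5 | (x < v)%N) g v =
  g x - (x == o0)%:R * \sum_v g v.
Proof.
have -> : g x = \sum_(v | v == x) g v by rewrite big_pred1_eq.
rewrite (big_mkcond (fun v : C5 => (prv x < v)%N)).
rewrite (big_mkcond (fun v : C5 => (x < v)%N)) (big_mkcond (fun v => v == x)).
rewrite mulr_sumr -!sumrB; apply: eq_bigr => v _.
have := prvK x; move/eqP; rewrite !eq_C5 nxt_val [nat_of_ord o0]/=.
have Hx := ltn_ord x; have Hv := ltn_ord v; have Hp := ltn_ord (prv x).
move: (nat_of_ord x) (nat_of_ord v) (nat_of_ord (prv x)) Hx Hv Hp => i j k.
move=> Hi Hj Hk e; case: (ltnP k j) => kj; case: (ltnP i j) => ij;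
  case: (eqVneq j i) => ji; case: (eqVneq i 0%N) => i0 /=; try ring; lia.
Qed.

(** A sum of differences along the cut path; the second boundary term is the
    value on the cut edge. *)
Lemma cut_telescope (g : C5 -> F) (x : C5) :
  \sum_(v : C5 | (x < v)%N) (g (prv v) - g v) = g x - g o4.
Proof.
rewrite sumrB (reindex_onto nxt prv) /=; last by move=> v _; rewrite prvK.
have -> : g x = \sum_(v | v == x) g v by rewrite big_pred1_eq.
have -> : g o4 = \sum_(v | v == o4) g v by rewrite big_pred1_eq.
rewrite (big_mkcond (fun v : C5 => (x < nxt v)%N && (prv (nxt v) == v))).
rewrite (big_mkcond (fun v : C5 => (x < v)%N)) (big_mkcond (fun v => v == x)).
rewrite (big_mkcond (fun v => v == o4)).
rewrite -!sumrB; apply: eq_bigr => v _; rewrite nxtK eqxx andbT !eq_C5 nxt_val.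
have Hx := ltn_ord x; have Hv := ltn_ord v.
rewrite [nat_of_ord o4]/=.
move: (nat_of_ord x) (nat_of_ord v) Hx Hv => i j Hi Hj.
case: (ltnP i j) => ij; case: (ltnP i (j.+1 %% 5)%N) => ij';
  case: (eqVneq j i) => ji; case: (eqVneq j 4%N) => j4 /=; try ring; lia.
Qed.

Lemma sum_prv (g : C5 -> F) : \sum_v (g (prv v) - g v) = 0.
Proof.
rewrite sumrB (reindex_onto nxt prv) /=; last by move=> v _; rewrite prvK.
apply/eqP; rewrite subr_eq0; apply/eqP.
by apply: eq_big => [v|v _]; rewrite nxtK ?eqxx.
Qed.

End FiveCycle.

(** * Size and degrees of the torus *)

Lemma degreeE (G : sgraph) (x : G) : degree x = (\sum_z (adj x z : nat))%N.
Proof.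
rewrite /degree -sum1_card big_mkcond; apply: eq_bigr => z _.
by rewrite inE; case: adj.
Qed.

Lemma degree_cart_prod (G H : sgraph) (x : G) (y : H) :
  @degree (cart_prod G H) (x, y) = (degree x + degree y)%N.
Proof.
rewrite !degreeE /=.
transitivity (\sum_v \sum_w ((y == w) * adj x v + (x == v) * adj y w))%N.
  rewrite pair_bigA; apply: eq_bigr => -[v w] _; rewrite /cart_adj /=.
  case: (eqVneq x v) => [<-|_]; case: (eqVneq y w) => [<-|_] //=;
  by rewrite ?adj_irr //= ?orbF; case: adj.
under eq_bigr do rewrite big_split /=.
rewrite big_split /=; congr (_ + _)%N.
  apply: eq_bigr => v _; rewrite -big_distrl /= (bigD1 y) //= eqxx.
  by rewrite big1 ?addn0 ?mul1n // => w wy; rewrite eq_sym (negbTE wy).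
rewrite exchange_big; apply: eq_bigr => w _ /=.
rewrite -big_distrl /= (bigD1 x) //= eqxx.
by rewrite big1 ?addn0 ?mul1n // => v vx; rewrite eq_sym (negbTE vx).
Qed.

Lemma degree_C5 (x : C5) : degree x = 2%N.
Proof.
rewrite /degree (eq_card (B := pred2 (nxt x) (prv x))); last first.
  by move=> z; rewrite !inE adj_prv_nxt.
by rewrite card2 eq_sym prv_neq_nxt.
Qed.

Lemma degree_torus r (x : cart_power C5 r) : degree x = (2 * r)%N.
Proof.
elim: r x => [|[|r] IH] x.
- by rewrite degreeE big1.
- exact: degree_C5.
have deg (u : cart_prod C5 (cart_power C5 r.+1)) : degree u = (2 * r.+2)%N.
  by case: u => a u; rewrite degree_cart_prod degree_C5 IH [RHS]mulnS.
exact: deg.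
Qed.

Lemma card_torus r : #|cart_power C5 r| = (5 ^ r)%N.
Proof.
elim: r => [|[|r] IH]; first exact: card_unit.
  exact: card_ord.
by rewrite [LHS]card_prod IH [X in (X * _)%N]card_ord [RHS]expnS.
Qed.

(** * Optimal transport along an edge *)

Section Distance.
Variable G : sgraph.
Implicit Types (u v : G) (f : G -> nat).

Lemma gdist_le_path u (p : seq G) : path (@adj G) u p ->
  (gdist u (last u p) <= size p)%N.
Proof.
move=> up; rewrite /gdist leqNgt; apply/negP => lt_find.
have sp : (size p < #|G|)%N.
  by apply: leq_trans lt_find _; rewrite (leq_trans (find_size _ _)) // size_iota.
have := before_find 0%N lt_find; rewrite nth_iota // add0n.
by move=> /negbT/existsPn/(_ (in_tuple p)); rewrite /= up eqxx.
Qed.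

Lemma gdist_refl u : gdist u u = 0%N.
Proof. by apply/eqP; rewrite -leqn0; apply: (@gdist_le_path u [::]). Qed.

Lemma lipschitz_path f u p : (forall v w, adj v w -> (f w <= (f v).+1)%N) ->
  path (@adj G) u p -> (f (last u p) <= f u + size p)%N.
Proof.
move=> lip; elim: p u => [|v p IH] u /=; first by rewrite addn0.
case/andP=> uv /IH le_p; apply: leq_trans le_p _.
by rewrite addnS -addSn leq_add2r lip.
Qed.

(** The bound by the number of vertices covers pairs in different components,
    where [gdist] takes that value. *)
Lemma lipschitz_gdist f u v : (forall v w, adj v w -> (f w <= (f v).+1)%N) ->
  (forall v, (f v <= #|G|)%N) -> (f v <= f u + gdist u v)%N.
Proof.
move=> lip bnd; rewrite /gdist; set P := fun n => _.
have [hasP|nP] := boolP (has P (iota 0 #|G|)); last first.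
  by rewrite (hasNfind nP) size_iota (leq_trans (bnd v)) // leq_addl.
have lt_find : (find P (iota 0 #|G|) < #|G|)%N.
  by rewrite -[X in (_ < X)%N](size_iota 0) -has_find.
have : P (find P (iota 0 #|G|)).
  by have := nth_find 0%N hasP; rewrite nth_iota // add0n.
rewrite {1}/P; move: (find _ _) => n /existsP[p /andP[up /eqP <-]].
rewrite -[X in (_ <= _ + X)%N](size_tuple p).
exact: lipschitz_path.
Qed.

End Distance.

Section Transport.
Variables (R : realType) (G : sgraph).

(** The easy half of Kantorovich duality. Integrating a Lipschitz potential
    bounds every transport cost from below, and a coupling that only moves mass
    along pairs where the Lipschitz bound is tight attains this value. *)
Lemma W1_potential (mu nu : G -> R) (f : G -> R) (pi : G -> G -> R) :
  (forall u v, f v - f u <= (gdist u v)%:R) ->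
  coupling mu nu pi ->
  (forall u v, pi u v != 0 -> (gdist u v)%:R <= f v - f u) ->
  W1 mu nu = \sum_v f v * nu v - \sum_u f u * mu u.
Proof.
move=> lip cpi tight.
have dual rho : coupling mu nu rho ->
    \sum_u \sum_v (f v - f u) * rho u v = \sum_v f v * nu v - \sum_u f u * mu u.
  case=> _ rmu rnu.
  rewrite (eq_bigr (fun u => \sum_v f v * rho u v - f u * mu u)) => [|u _].
    rewrite sumrB exchange_big /=; congr (_ - _); apply: eq_bigr => v _.
    by rewrite -mulr_sumr rnu.
  by rewrite -rmu mulr_sumr -sumrB; apply: eq_bigr => v _; rewrite mulrBl.
have lower rho : coupling mu nu rho ->
    \sum_v f v * nu v - \sum_u f u * mu u <= transport_cost rho.
  move=> crho; rewrite -(dual _ crho); have [rho0 _ _] := crho.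
  by apply: ler_sum => u _; apply: ler_sum => v _; apply: ler_wpM2r.
have costE : transport_cost pi = \sum_v f v * nu v - \sum_u f u * mu u.
  rewrite -(dual _ cpi); apply: eq_bigr => u _; apply: eq_bigr => v _.
  have [->|n0] := eqVneq (pi u v) 0; first by rewrite !mulr0.
  by congr (_ * _); apply/eqP; rewrite eq_le lip tight.
apply/eqP; rewrite eq_le; apply/andP; split.
  rewrite -costE; apply: ge_inf; last by exists pi.
  by exists (\sum_v f v * nu v - \sum_u f u * mu u) => _ [rho crho <-]; apply: lower.
apply: lb_le_inf; first by exists (transport_cost pi), pi.
by move=> _ [rho crho <-]; apply: lower.
Qed.

End Transport.

(** In the torus [tau] rotates one coordinate by one step, so that the orbit of
    [x] is a pentagon containing the edge, and [f] is the distance to the vertex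
    [tau' x] before [x] measured in that coordinate. Stated through [tau] and
    [f], the situation passes from a factor to a product on either side, which
    is what the induction on the number of factors needs. The last condition on
    [tau] closes the pentagon: it puts [tau' x] and [tau y] at distance two. *)
Definition shift_edge (G : sgraph) (x y : G) (tau tau' : G -> G) (f : G -> nat) :=
  [/\ [/\ cancel tau tau', cancel tau' tau,
          forall u v, adj (tau u) (tau v) = adj u v,
          forall u, adj u (tau u) & tau x = y /\ tau (tau (tau y)) = tau' x],
      forall u v, adj u v -> (f v <= (f u).+1)%N,
      forall u, (f u <= 2)%N,
      [/\ f (tau' x) = 0%N, f x = 1%N, f y = 2%N & f (tau y) = 2%N] &
      forall z, adj x z -> z != tau' x -> z != y -> f z = 1%N /\ f (tau z) = 2%N].

Section ShiftEdge.
Variables (R : realType) (G : sgraph) (d : nat).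
Hypothesis degG : forall x : G, degree x = d.
Variables (x y : G) (tau tau' : G -> G) (f : G -> nat).
Hypothesis sh : shift_edge x y tau tau' f.

Let x' := tau' x.
Let y' := tau y.

Let tauK : cancel tau tau'. Proof. by case: sh => -[]. Qed.
Let tau'K : cancel tau' tau. Proof. by case: sh => -[]. Qed.
Let tau_adj u v : adj (tau u) (tau v) = adj u v. Proof. by case: sh => -[]. Qed.
Let adj_tau u : adj u (tau u). Proof. by case: sh => -[]. Qed.
Let tau_x : tau x = y. Proof. by case: sh => -[_ _ _ _ []]. Qed.
Let tau3y : tau (tau y') = x'. Proof. by case: sh => -[_ _ _ _ []]. Qed.
Let lip u v : adj u v -> (f v <= (f u).+1)%N. Proof. by case: sh => _ + *; apply. Qed.
Let f2 u : (f u <= 2)%N. Proof. by case: sh. Qed.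
Let fx' : f x' = 0%N. Proof. by case: sh => _ _ _ []. Qed.
Let fx : f x = 1%N. Proof. by case: sh => _ _ _ []. Qed.
Let fy : f y = 2%N. Proof. by case: sh => _ _ _ []. Qed.
Let fy' : f y' = 2%N. Proof. by case: sh => _ _ _ []. Qed.
Let fz z : adj x z -> z != x' -> z != y -> f z = 1%N /\ f (tau z) = 2%N.
Proof. by case: sh => _ _ _ _; apply. Qed.

Let xy : adj x y. Proof. by rewrite -tau_x. Qed.
Let xx' : adj x x'. Proof. by have := adj_tau x'; rewrite tau'K adj_sym. Qed.

Let neq_f u v : f u != f v -> (u == v) = false.
Proof. by move=> fuv; apply/negbTE; apply: contraNneq fuv => ->. Qed.

Lemma shift_lipschitz u v : (f v)%:R - (f u)%:R <= (gdist u v)%:R :> R.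
Proof.
rewrite lerBlDl -natrD ler_nat; apply: lipschitz_gdist => // w.
apply: leq_trans (f2 w) _; rewrite (cardD1 x) (cardD1 y) !inE.
by rewrite neq_f ?fx ?fy.
Qed.

Lemma shift_gdist : gdist x y = 1%N.
Proof.
apply/eqP; rewrite eqn_leq (gdist_le_path (p := [:: y])) /= ?xy //.
by have := shift_lipschitz x y; rewrite fx fy -natrB // ler_nat.
Qed.

Let off_pentagon u := [&& adj x u, u != x' & u != y].

(** The rotation [tau] already transports one measure to the other at cost one.
    It is improved along the pentagon: [x] and [y] keep the mass [m] that both
    measures have there, and the mass at [tau' x] goes to [tau y] around the
    back of the pentagon. *)
Definition shift_coupling (a m : R) (u v : G) : R :=
  (a - m) *+ ((u == x) && (v == y)) + m *+ ((u == x) && (v == x)) +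
  m *+ ((u == y) && (v == y)) + m *+ ((u == x') && (v == y')) +
  m *+ (off_pentagon u && (v == tau u)).

Let sum_single (I : finType) (c : I) (k : R) (b : bool) :
  \sum_v k *+ (b && (v == c)) = k *+ b.
Proof.
rewrite (bigD1 c) //= big1 ?addr0 ?eqxx ?andbT // => v vc.
by rewrite (negbTE vc) andbF.
Qed.

(** Here [m] is the mass of one neighbour and [a] the mass of the centre, so
    [m <= a] makes the entry [a - m] nonnegative. *)
Lemma shift_couplingP (a m : R) : 0 <= m -> m <= a -> m * d%:R = 1 - a ->
  (0 < d)%N ->
  coupling (lazy_measure a x) (lazy_measure a y) (shift_coupling a m).
Proof.
move=> m0 ma md d0.
have mE : (1 - a) / d%:R = m by rewrite -md mulfK // pnatr_eq0 -lt0n.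
rewrite /lazy_measure !degG mE; split=> [u v|u|v].
- by rewrite !addr_ge0 ?mulrn_wge0 ?subr_ge0.
- rewrite /shift_coupling !big_split /= !sum_single /off_pentagon.
  have [->|ux] := eqVneq u x.
    by rewrite adj_irr !neq_f ?fx ?fy ?fx' //= ?mulrb /=; ring.
  have [->|uy] := eqVneq u y.
    by rewrite xy neq_f ?fx' ?fy // andbF ?mulrb /=; ring.
  have [->|ux'] := eqVneq u x'; first by rewrite xx' andbF ?mulrb /=; ring.
  by rewrite !andbT; case: adj; rewrite /= ?mulrb /=; ring.
rewrite /shift_coupling !big_split /=.
have swap (c : G) (k : R) (b : bool) :
    \sum_u k *+ ((u == c) && b) = k *+ b.
  by under eq_bigr do rewrite andbC; rewrite sum_single.
rewrite !swap.
have -> : \sum_u m *+ (off_pentagon u && (v == tau u)) = m *+ off_pentagon (tau' v).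
  rewrite (bigD1 (tau' v)) //= tau'K eqxx andbT big1 ?addr0 // => u uv.
  by rewrite -(can2_eq tauK tau'K) in uv; rewrite eq_sym (negbTE uv) andbF.
have -> : off_pentagon (tau' v) = [&& adj y v, v != x & v != y'].
  rewrite /off_pentagon -tau_adj tau_x tau'K /x' /y'.
  by rewrite (can_eq tau'K) (can2_eq tau'K tauK).
have yy' : (y == y') = false by apply/negbTE/adj_neq.
have [->|vy] := eqVneq v y.
  by rewrite adj_irr yy' neq_f ?fx ?fy //= ?mulrb /=; ring.
have [->|vx] := eqVneq v x.
  by rewrite adj_sym xy neq_f ?fx ?fy' // andbF ?mulrb /=; ring.
have [->|vy'] := eqVneq v y'; first by rewrite adj_tau andbF ?mulrb /=; ring.
by rewrite !andbT; case: adj; rewrite /= ?mulrb /=; ring.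
Qed.

Lemma shift_coupling_tight (a m : R) u v : shift_coupling a m u v != 0 ->
  (gdist u v)%:R <= (f v)%:R - (f u)%:R :> R.
Proof.
rewrite lerBrDl -natrD ler_nat => n0.
have : [|| (u == x) && (v == y), (u == x) && (v == x), (u == y) && (v == y),
           (u == x') && (v == y') | off_pentagon u && (v == tau u)].
  apply: contraNT n0; rewrite !negb_or /shift_coupling.
  case/and5P=> /negbTE-> /negbTE-> /negbTE-> /negbTE-> /negbTE->.
  by rewrite !mulr0n !addr0.
case/or4P=> [|||/orP[]] /andP[]; last first.
- case/and3P=> xu ux' uy /eqP->; have [-> ->] := fz xu ux' uy.
  have := gdist_le_path (u := u) (p := [:: tau u]); rewrite /= adj_tau.
  exact.
- move=> /eqP-> /eqP->; rewrite fx' fy'.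
  have := gdist_le_path (u := x') (p := [:: tau y'; y']); apply.
  by rewrite /= -{1}tau3y adj_sym adj_tau adj_sym adj_tau.
- by move=> /eqP-> /eqP->; rewrite gdist_refl addn0.
- by move=> /eqP-> /eqP->; rewrite gdist_refl addn0.
- by move=> /eqP-> /eqP->; rewrite shift_gdist fx fy.
Qed.

Lemma shift_W1 (a : R) : (0 < d)%N -> a < 1 -> 1 - a <= a * d%:R ->
  W1 (lazy_measure a x) (lazy_measure a y) = 1 - (1 - a) / d%:R.
Proof.
move=> d0 a1 ad; set m := (1 - a) / d%:R.
have dp : 0 < d%:R :> R by rewrite ltr0n.
have md : m * d%:R = 1 - a by rewrite /m divfK // gt_eqF.
have m0 : 0 <= m by rewrite divr_ge0 ?ltW // subr_gt0.
have ma : m <= a by rewrite ler_pdivrMr.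
rewrite (W1_potential shift_lipschitz (shift_couplingP m0 ma md d0)
  (@shift_coupling_tight a m)).
have meanE (w : G) (g : G -> R) :
    \sum_v g v * lazy_measure a w v = g w * a + m * \sum_(v | adj w v) g v.
  rewrite (bigD1 w) //= {1}/lazy_measure eqxx; congr (_ + _).
  rewrite mulr_sumr big_mkcond [RHS]big_mkcond; apply: eq_bigr => v _.
  rewrite /lazy_measure degG; have [->|vw] := eqVneq v w; first by rewrite adj_irr.
  by case: ifP => _ /=; rewrite ?mulr0 // mulrC.
rewrite !meanE.
have -> : \sum_(v | adj y v) (f v)%:R = \sum_(u | adj x u) (f (tau u))%:R :> R.
  rewrite (reindex tau) /=; last by exists tau' => u _; rewrite ?tauK ?tau'K.
  by apply: eq_bigl => u; rewrite -tau_x tau_adj.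
have x'y : x' != y by apply/negbT/neq_f; rewrite fx' fy.
have cardx : \sum_(u | adj x u) 1 = d%:R :> R.
  by rewrite sumr_const -(degG x).
have -> : \sum_(u | adj x u) (f (tau u))%:R =
    \sum_(u | adj x u) (f u)%:R + d%:R - 1 :> R.
  rewrite -cardx -big_split /= (bigD1 y) //= [in RHS](bigD1 y) //=.
  rewrite (eq_bigr (fun u => (f u)%:R + 1)) => [|u /andP[xu uy]].
    by rewrite fy fy'; ring.
  have [->|ux'] := eqVneq u x'; first by rewrite tau'K fx fx' add0r.
  by have [-> ->] := fz xu ux' uy; rewrite -natr1.
by rewrite fx fy; ring: md.
Qed.

(** The coupling exists as soon as [a >= 1 / (d + 1)], and from there on the
    quotient defining the curvature is constant. *)
Lemma shift_curvature : (0 < d)%N -> has_LLY_curvature x y (1 / d%:R : R).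
Proof.
move=> d0; have dp : 0 < d%:R :> R by rewrite ltr0n.
rewrite /has_LLY_curvature; apply: cvg_near_cst; near=> a.
have a1 : a < 1 by near: a; exact: nbhs_left_lt.
have ad : 1 / (d%:R + 1) <= a.
  by near: a; apply: nbhs_left_ge; rewrite ltr_pdivrMr ?mul1r; lra.
rewrite /kappa shift_gdist shift_W1 //.
  by rewrite divr1 opprB addrC subrK; field; rewrite !gt_eqF // subr_gt0.
by move: ad; rewrite ler_pdivrMr ?addr_gt0 // mulrDr mulr1 lerBlDr.
Unshelve. all: by end_near. Qed.

End ShiftEdge.

Lemma shift_edge_prodl (G H : sgraph) (x y : G) (h : H) tau tau' f :
  shift_edge x y tau tau' f ->
  @shift_edge (cart_prod G H) (x, h) (y, h)
    (fun u => (tau u.1, u.2)) (fun u => (tau' u.1, u.2)) (fun u => f u.1).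
Proof.
move=> [[tauK tau'K tadj adjt [tx t3]] lip f2 [fx' fx fy fy'] fz].
split=> /=; [split=> /= | | | by split | ].
- by case=> u v /=; rewrite tauK.
- by case=> u v /=; rewrite tau'K.
- by move=> u v; rewrite /cart_adj /= tadj (can_eq tauK).
- by move=> u; rewrite /cart_adj /= eqxx adjt orbT.
- by rewrite tx t3.
- by move=> [u1 u2] [v1 v2]; rewrite /cart_adj /= => /orP[/andP[/eqP-> _]|/andP[_ /lip]].
- by [].
move=> [z1 z2]; rewrite /cart_adj /= => /orP[/andP[/eqP<- _] _ _|].
  by rewrite tx.
case/andP=> /eqP<- xz n1 n2; apply: fz => //.
  by apply: contraNneq n1 => ->.
by apply: contraNneq n2 => ->.
Qed.

Lemma shift_edge_prodr (G H : sgraph) (x y : H) (h : G) tau tau' f :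
  shift_edge x y tau tau' f ->
  @shift_edge (cart_prod G H) (h, x) (h, y)
    (fun u => (u.1, tau u.2)) (fun u => (u.1, tau' u.2)) (fun u => f u.2).
Proof.
move=> [[tauK tau'K tadj adjt [tx t3]] lip f2 [fx' fx fy fy'] fz].
split=> /=; [split=> /= | | | by split | ].
- by case=> u v /=; rewrite tauK.
- by case=> u v /=; rewrite tau'K.
- by move=> u v; rewrite /cart_adj /= tadj (can_eq tauK).
- by move=> u; rewrite /cart_adj /= eqxx adjt.
- by rewrite tx t3.
- by move=> [u1 u2] [v1 v2]; rewrite /cart_adj /= => /orP[/andP[_ /lip]|/andP[/eqP-> _]].
- by [].
move=> [z1 z2]; rewrite /cart_adj /= => /orP[|/andP[/eqP<- _] _ _]; last first.
  by rewrite tx.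
case/andP=> /eqP<- xz n1 n2; apply: fz => //.
  by apply: contraNneq n1 => ->.
by apply: contraNneq n2 => ->.
Qed.

(** * Curvature of the edges of the torus *)

Lemma shift_edge_C5_nxt (x : C5) : shift_edge x (nxt x) nxt prv
  (fun z => if z == prv x then 0 else if (z == x) || (z == prv (prv x))
            then 1 else 2)%N.
Proof.
split; first split.
- exact: nxtK.
- exact: prvK.
- exact: adj_nxt2.
- exact: adj_nxt.
- by split=> //; case: x => -[|[|[|[|[|//]]]]] i; apply: val_inj.
- by case: x => -[|[|[|[|[|//]]]]] i [[|[|[|[|[|//]]]]] j] [[|[|[|[|[|//]]]]] k].
- by move=> u; case: ifP => // _; case: ifP.
- by case: x => -[|[|[|[|[|//]]]]] i.
by case: x => -[|[|[|[|[|//]]]]] i [[|[|[|[|[|//]]]]] j].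
Qed.

Lemma shift_edge_C5_prv (x : C5) : shift_edge x (prv x) prv nxt
  (fun z => if z == nxt x then 0 else if (z == x) || (z == nxt (nxt x))
            then 1 else 2)%N.
Proof.
split; first split.
- exact: prvK.
- exact: nxtK.
- by move=> u v; rewrite -adj_nxt2 !prvK.
- by move=> u; rewrite adj_prv_nxt eqxx orbT.
- by split=> //; case: x => -[|[|[|[|[|//]]]]] i; apply: val_inj.
- by case: x => -[|[|[|[|[|//]]]]] i [[|[|[|[|[|//]]]]] j] [[|[|[|[|[|//]]]]] k].
- by move=> u; case: ifP => // _; case: ifP.
- by case: x => -[|[|[|[|[|//]]]]] i.
by case: x => -[|[|[|[|[|//]]]]] i [[|[|[|[|[|//]]]]] j].
Qed.

Lemma torus_shift_edge r (x y : cart_power C5 r) : adj x y ->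
  exists tau tau' f, shift_edge x y tau tau' f.
Proof.
have C5_edge (a b : C5) : adj a b -> exists tau tau' f, shift_edge a b tau tau' f.
  rewrite adj_prv_nxt => /orP[/eqP->|/eqP->]; do 3 eexists.
    exact: shift_edge_C5_nxt.
  exact: shift_edge_C5_prv.
elim: r x y => [//|[|r] IH]; first exact: C5_edge.
move=> [a x] [b y]; rewrite /= /cart_adj /= => /orP[] /andP[/eqP<-].
  move=> /IH[tau [tau' [f /(shift_edge_prodr a) sh]]].
  by do 3 eexists; exact: sh.
move=> /C5_edge[tau [tau' [f /(shift_edge_prodl x) sh]]].
by do 3 eexists; exact: sh.
Qed.

(** * Path chains as functions on lists *)

Section Chains.
Variables (F : fieldType) (V : finType).
Implicit Types (f g : seq V -> F) (s t : seq V) (P : pred (seq V)).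

(** A chain is encoded by its coefficient function on all lists of vertices. The
    coefficient of its boundary at [s] collects, with signs, the coefficients at
    the lists from which [s] arises by deleting an entry. The recursion separates
    insertion before the head of [s] from insertion after it, which changes the
    sign. *)
Fixpoint delta f s : F :=
  \sum_v f (v :: s) -
  (if s is x :: s' then delta (fun t => f (x :: t)) s' else 0).

Lemma delta_cons f x s :
  delta f (x :: s) =
  \sum_v f (v :: x :: s) - delta (fun t => f (x :: t)) s.
Proof. by []. Qed.

Lemma eq_delta f g : f =1 g -> delta f =1 delta g.
Proof.
move=> fg s; elim: s f g fg => [|x s IH] f g fg /=.
  by congr (_ - _); apply: eq_bigr => v _; rewrite fg.
congr (_ - _); first by apply: eq_bigr => v _; rewrite fg.
by apply: IH => t; rewrite fg.
Qed.

Lemma delta0 f s : (forall t, f t = 0) -> delta f s = 0.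
Proof.
elim: s f => [|x s IH] f f0 /=; rewrite big1 ?subr0 //.
by rewrite IH ?subr0.
Qed.

Lemma deltaD f g s :
  delta (fun t => f t + g t) s = delta f s + delta g s.
Proof.
elim: s f g => [|x s IH] f g /=; rewrite big_split /=.
  by rewrite !subr0.
by rewrite IH; ring.
Qed.

Lemma deltaZ a f s : delta (fun t => a * f t) s = a * delta f s.
Proof.
elim: s f => [|x s IH] f /=; rewrite -mulr_sumr.
  by rewrite !subr0.
by rewrite IH mulrBr.
Qed.

Lemma deltaB f g s :
  delta (fun t => f t - g t) s = delta f s - delta g s.
Proof.
rewrite -[X in _ - X]mul1r -mulNr -deltaZ -deltaD.
by apply: eq_delta => t; rewrite mulN1r.
Qed.

Lemma delta_sum (I : Type) (r : seq I) (P : pred I) (z : I -> seq V -> F) s :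
  delta (fun t => \sum_(i <- r | P i) z i t) s =
  \sum_(i <- r | P i) delta (z i) s.
Proof.
elim: r => [|i r IH]; first by rewrite big_nil delta0 // => t; rewrite big_nil.
rewrite big_cons -IH; case: ifP => Pi; last first.
  by apply: eq_delta => t; rewrite big_cons Pi.
by rewrite -deltaD; apply: eq_delta => t; rewrite big_cons Pi.
Qed.

(** Insertion lengthens a list by one, so the boundary anticommutes with the
    parity of the length. *)
Lemma delta_sign f s :
  delta (fun t => (-1) ^+ size t * f t) s = - ((-1) ^+ size s * delta f s).
Proof.
elim: s f => [|x s IH] f /=; rewrite -mulr_sumr.
  by rewrite !subr0; ring.
have -> : delta (fun t => (-1) ^+ (size t).+1 * f (x :: t)) s =
          - delta (fun t => (-1) ^+ size t * f (x :: t)) s.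
  rewrite -[RHS]mulN1r -deltaZ; apply: eq_delta => t.
  by rewrite exprS mulrA.
by rewrite IH !exprS; ring.
Qed.

(** If [f] vanishes on all lists containing the step from [a] to [d], deleting an
    entry produces this step only when the entry stood between [a] and [d]. *)
Lemma delta_inner f a d l r :
  (forall l' r', f (l' ++ a :: d :: r') = 0) ->
  delta f (l ++ a :: d :: r) =
  (-1) ^+ (size l).+1 * \sum_b f (l ++ a :: b :: d :: r).
Proof.
elim: l f => [|x l IH] f f0 /=.
  rewrite big1 => [|v _]; last by rewrite -cat1s f0.
  rewrite [X in _ - (_ - X)]delta0 => [|t]; last by rewrite (f0 [::]).
  by rewrite subr0 expr1; ring.
rewrite big1 => [|v _]; last by rewrite -!cat_cons f0.
by rewrite IH => [|l' r']; [rewrite [in RHS]exprS; ring | rewrite -cat_cons f0].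
Qed.

Lemma delta_size f s :
  (forall t, size t = (size s).+1 -> f t = 0) -> delta f s = 0.
Proof.
elim: s f => [|x s IH] f f0 /=.
  by rewrite big1 ?subr0 // => v _; apply: f0.
rewrite big1 => [|v _]; last exact: f0.
by rewrite IH ?subr0 // => t st; apply: f0; rewrite /= st.
Qed.

Lemma delta_insert f s :
  delta f s = \sum_(q < (size s).+1) (-1) ^+ q *
                \sum_v f (take q s ++ v :: drop q s).
Proof.
elim: s f => [|x s IH] f.
  by rewrite /= big_ord_recl big_ord0 subr0 addr0 mul1r.
rewrite delta_cons IH [RHS]big_ord_recl /= expr0 mul1r; congr (_ + _).
rewrite -sumrN; apply: eq_bigr => q _.
by rewrite /= exprS mulN1r mulNr.
Qed.

Definition vanish_off P f := forall s, ~~ P s -> f s = 0.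

(** The boundary on regular chains: its coefficients at nonregular lists are
    discarded because these paths are zero, and the one at the empty list because
    the complex is not augmented. *)
Definition bdry f s := if (s != [::]) && regular s then delta f s else 0.

Lemma eq_bdry f g : f =1 g -> bdry f =1 bdry g.
Proof. by move=> fg s; rewrite /bdry (eq_delta fg). Qed.

Lemma bdry_sum (I : Type) (r : seq I) (c : I -> F) (z : I -> seq V -> F) s :
  bdry (fun t => \sum_(i <- r) c i * z i t) s =
  \sum_(i <- r) c i * bdry (z i) s.
Proof.
rewrite /bdry; case: ifP => _.
  by rewrite delta_sum; apply: eq_bigr => i _; rewrite deltaZ.
by rewrite big1 // => i _; rewrite mulr0.
Qed.

Lemma bdryD f g s : bdry (fun t => f t + g t) s = bdry f s + bdry g s.
Proof. by rewrite /bdry; case: ifP => _; rewrite ?deltaD ?addr0. Qed.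

Lemma bdryZ a f s : bdry (fun t => a * f t) s = a * bdry f s.
Proof. by rewrite /bdry; case: ifP => _; rewrite ?deltaZ ?mulr0. Qed.

Lemma bdry_vanish f s : ~~ ((s != [::]) && regular s) -> bdry f s = 0.
Proof. by rewrite /bdry => /negbTE ->. Qed.

Lemma bdry_size f s :
  (forall t, size t = (size s).+1 -> f t = 0) -> bdry f s = 0.
Proof. by move=> f0; rewrite /bdry delta_size // if_same. Qed.

End Chains.

Section OmegaLists.
Variables (F : fieldType) (G : sgraph).
Implicit Types (f g : seq G -> F) (s t : seq G).

Definition walk s := (s != [::]) && sorted (@adj G) s.

(** The index [m] counts vertices and exceeds the degree of a path by one. In this
    indexing the degree [-1] that occurs in the Kuenneth recursion is [m = 0],
    where there are no walks. *)
Definition walk_of (m : nat) s := walk s && (size s == m).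

Definition omega (m : nat) f :=
  vanish_off (walk_of m) f /\ vanish_off walk (bdry f).

Definition cycle_fun m f := vanish_off (walk_of m) f /\ forall s, bdry f s = 0.

Lemma cycle_omega m f : cycle_fun m f -> omega m f.
Proof. by case=> f1 f2; split=> // s _; rewrite f2. Qed.

Lemma omegaD m f g : omega m f -> omega m g -> omega m (fun s => f s + g s).
Proof.
move=> [f1 f2] [g1 g2]; split=> s sW; first by rewrite f1 // g1 // addr0.
by rewrite bdryD f2 // g2 // addr0.
Qed.

Lemma omegaZ m a f : omega m f -> omega m (fun s => a * f s).
Proof.
move=> [f1 f2]; split=> s sW; first by rewrite f1 // mulr0.
by rewrite bdryZ f2 // mulr0.
Qed.

Lemma eq_omega m f g : f =1 g -> omega m f -> omega m g.
Proof.
move=> fg [f1 f2]; split=> s sW; first by rewrite -fg f1.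
by rewrite -(eq_bdry fg) f2.
Qed.

Lemma walk_regular s : sorted (@adj G) s -> regular s.
Proof. by apply: sub_sorted => x y; exact: adj_neq. Qed.

(** The local form of the condition on the boundary: the step from [a] to [d] is
    not allowed, so the ways to fill it in by a vertex [b] must cancel. *)
Lemma omega_inner m f a d l r : omega m f -> a != d -> ~~ adj a d ->
  \sum_b f (l ++ a :: b :: d :: r) = 0.
Proof.
move=> [f1 f2] ad Nad.
have Nw l' r' : ~~ walk (l' ++ a :: d :: r').
  rewrite /walk; case: l' => [|x l'] /=; first by rewrite (negbTE Nad).
  by rewrite cat_path /= (negbTE Nad) !andbF.
have f0 l' r' : f (l' ++ a :: d :: r') = 0.
  by apply: f1; rewrite /walk_of (negbTE (Nw _ _)).
have [reg|nreg] := boolP (regular (l ++ a :: d :: r)).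
  have := f2 _ (Nw l r); rewrite /bdry reg andbT.
  have -> : l ++ a :: d :: r != [::] by case: (l).
  rewrite delta_inner // => /eqP; rewrite mulf_eq0 signr_eq0 /=.
  by move/eqP.
apply: big1 => b _; apply: f1; apply: contra nreg.
case/andP=> /andP[_]; rewrite /regular.
have E x l' : path (@adj G) x l' -> path (fun i j => i != j) x l'.
  by apply: sub_path => u v; exact: adj_neq.
case: l => [|x l] /=.
  by case/and3P=> _ _ /E ->; rewrite ad.
by rewrite !cat_path /= => /and5P[/E -> /adj_neq -> _ _ /E ->]; rewrite ad.
Qed.

End OmegaLists.

(** * The cross product and its boundary *)

Fixpoint destutter (T : eqType) (a : T) (l : seq T) : seq T :=
  if l is a' :: l' then
    if a' == a then destutter a l' else a' :: destutter a' l'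
  else [::].

Lemma destutter_path (T : eqType) (a : T) l :
  path (fun i j => i != j) a (destutter a l).
Proof.
elim: l a => [//|a' l IH] a /=.
by case: eqVneq => [_|ne] //=; rewrite eq_sym ne IH.
Qed.

Section Staircase.
Variables (F : fieldType) (X Y : sgraph).
Implicit Types (a x : X) (b y : Y) (s : seq X) (t : seq Y).
Implicit Types (z : seq (cart_prod X Y)) (c : seq X -> seq Y -> F).

(** The path [z] continues from [(a, b)]. It is a staircase if each step changes
    exactly one coordinate; otherwise the value is 0. The sign is the parity of
    the number of pairs of a vertical step and a later horizontal step, that is
    of the number of cells on one side of the staircase. *)
Fixpoint stair_sign a b (z : seq (X * Y)) : F :=
  if z is (a', b') :: z' then
    if a' == a then
      if b' == b then 0
      else (-1) ^+ size (destutter a (map fst z')) * stair_sign a b' z'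
    else if b' == b then stair_sign a' b z' else 0
  else 1.

(** The cross product of path chains, for a coefficient function [c] on pairs of
    paths: each staircase receives the coefficient of its two projections. Paths
    are given by what follows the base points [a] and [b]. *)
Definition cross_from a b c (z : seq (X * Y)) : F :=
  stair_sign a b z * c (destutter a (map fst z)) (destutter b (map snd z)).

Lemma cross_nil a b c : cross_from a b c [::] = c [::] [::].
Proof. by rewrite /cross_from /= mul1r. Qed.

Lemma cross_horiz a b c a' z : a' != a ->
  cross_from a b c ((a', b) :: z) = cross_from a' b (fun s t => c (a' :: s) t) z.
Proof. by move=> /negbTE ne; rewrite /cross_from /= ne eqxx. Qed.

Lemma cross_vert a b c b' z : b' != b ->
  cross_from a b c ((a, b') :: z) =
  cross_from a b' (fun s t => (-1) ^+ size s * c s (b' :: t)) z.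
Proof. by move=> /negbTE ne; rewrite /cross_from /= ne eqxx mulrCA mulrA. Qed.

Lemma cross_diag a b c a' b' z : a' != a -> b' != b ->
  cross_from a b c ((a', b') :: z) = 0.
Proof. by move=> /negbTE ne /negbTE ne'; rewrite /cross_from /= ne ne' mul0r. Qed.

Lemma cross_stay a b c z : cross_from a b c ((a, b) :: z) = 0.
Proof. by rewrite /cross_from /= !eqxx mul0r. Qed.

Lemma cross_ext a b c c' z :
  (forall s t, path (fun i j => i != j) a s -> path (fun i j => i != j) b t ->
     c s t = c' s t) ->
  cross_from a b c z = cross_from a b c' z.
Proof. by move=> e; rewrite /cross_from e ?destutter_path. Qed.

Lemma cross0 a b c z : (forall s t, c s t = 0) -> cross_from a b c z = 0.
Proof. by move=> e; rewrite /cross_from e mulr0. Qed.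

Lemma crossD a b c c' z :
  cross_from a b (fun s t => c s t + c' s t) z =
  cross_from a b c z + cross_from a b c' z.
Proof. by rewrite /cross_from mulrDr. Qed.

Lemma crossN a b c z :
  cross_from a b (fun s t => - c s t) z = - cross_from a b c z.
Proof. by rewrite /cross_from mulrN. Qed.

Lemma cross_sum (I : Type) (r : seq I) (P : pred I) a b (c : I -> _) z :
  cross_from a b (fun s t => \sum_(i <- r | P i) c i s t) z =
  \sum_(i <- r | P i) cross_from a b (c i) z.
Proof. by rewrite /cross_from mulr_sumr. Qed.

Definition bidelta c s t : F :=
  delta (c^~ t) s + (-1) ^+ size s * delta (c s) t.

Lemma sum_cart (f : cart_prod X Y -> F) :
  \sum_p f p = \sum_x \sum_y f (x, y).
Proof. by rewrite pair_bigA; apply: eq_bigr => -[]. Qed.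

(** A vertex put before a horizontal step leaves a staircase only if it lies on
    the same horizontal line, where it subdivides the step of the projection. *)
Lemma cross_insert_horiz a b c a' z : a' != a ->
  (forall s t, ~~ path (fun i j => i != j) a s -> c s t = 0) ->
  \sum_(p : cart_prod X Y) cross_from a b c (p :: (a', b) :: z) =
  cross_from a' b (fun s t => \sum_v c (v :: a' :: s) t) z.
Proof.
move=> ne c0; rewrite cross_sum sum_cart.
apply: eq_bigr => v _; rewrite (bigD1 b) //= big1 => [|w wb]; last first.
  have [->|va] := eqVneq v a; last by rewrite cross_diag.
  by rewrite cross_vert // cross_diag // eq_sym.
rewrite addr0; have [->|va] := eqVneq v a.
  by rewrite cross_stay cross0 // => s t; rewrite c0 //= eqxx.
rewrite cross_horiz //; have [->|a'v] := eqVneq a' v.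
  by rewrite cross_stay cross0 // => s t; rewrite c0 //= eqxx andbF.
by rewrite cross_horiz.
Qed.

Lemma cross_insert_vert a b c b' z : b' != b ->
  (forall s t, ~~ path (fun i j => i != j) b t -> c s t = 0) ->
  \sum_(p : cart_prod X Y) cross_from a b c (p :: (a, b') :: z) =
  cross_from a b' (fun s t => \sum_w c s (w :: b' :: t)) z.
Proof.
move=> ne c0; rewrite cross_sum sum_cart.
rewrite exchange_big; apply: eq_bigr => w _ /=.
rewrite (bigD1 a) //= big1 => [|v va]; last first.
  have [->|wb] := eqVneq w b; last by rewrite cross_diag.
  by rewrite cross_horiz // cross_diag // eq_sym.
rewrite addr0; have [->|wb] := eqVneq w b.
  by rewrite cross_stay cross0 // => s t; rewrite c0 //= eqxx.
rewrite cross_vert //; have [->|b'w] := eqVneq b' w.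
  by rewrite cross_stay cross0 // => s t; rewrite c0 //= eqxx andbF.
rewrite cross_vert //; apply: cross_ext => s t _ _.
by rewrite mulrA -expr2 sqrr_sign mul1r.
Qed.

(** A diagonal step can be filled in by either corner of the square; the two
    staircases differ by one cell and their signs cancel. *)
Lemma cross_insert_diag a b c a' b' z : a' != a -> b' != b ->
  \sum_(p : cart_prod X Y) cross_from a b c (p :: (a', b') :: z) = 0.
Proof.
move=> na nb; rewrite sum_cart.
rewrite (bigD1 a) //= (bigD1 a') //= [X in _ + (_ + X)]big1 => [|v]; last first.
  case/andP=> va va'; apply: big1 => w _.
  have [->|wb] := eqVneq w b; last by rewrite cross_diag.
  by rewrite cross_horiz // cross_diag // eq_sym.
rewrite addr0 (bigD1 b') //= [X in _ + X + _]big1 => [|w wb']; last first.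
  have [->|wb] := eqVneq w b; first by rewrite cross_stay.
  by rewrite cross_vert // cross_diag // eq_sym.
rewrite (bigD1 b (P := predT)) //= [X in _ + (_ + X)]big1 => [|w wb]; last first.
  by rewrite cross_diag.
rewrite !addr0 cross_vert // !cross_horiz // cross_vert // -crossD.
by apply: cross0 => s t; rewrite exprS; ring.
Qed.

(** The product rule for the cross product, by the type of the first step of
    [z]. The regularity assumptions on [c] remove the insertions that repeat a
    vertex of a projection. *)
Lemma delta_cross a b c z :
  (forall s t, ~~ path (fun i j => i != j) a s -> c s t = 0) ->
  (forall s t, ~~ path (fun i j => i != j) b t -> c s t = 0) ->
  path (fun i j => i != j) (a, b) z ->
  delta (cross_from a b c) z = cross_from a b (bidelta c) z.
Proof.
elim: z a b c => [|[a' b'] z IH] a b c ca cb /=.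
  move=> _; rewrite cross_nil /bidelta /= !subr0 expr0 mul1r.
  rewrite sum_cart.
  rewrite (bigD1 a) //= [X in X + _ = _](bigD1 b) //= cross_stay add0r addrC.
  congr (_ + _).
    rewrite [RHS](bigD1 a) //= ca /= ?eqxx // add0r.
    apply: eq_bigr => v va; rewrite (bigD1 b) //= cross_horiz // cross_nil.
    by rewrite big1 ?addr0 // => w wb; rewrite cross_diag.
  rewrite [RHS](bigD1 b) //= cb /= ?eqxx // add0r.
  by apply: eq_bigr => w wb; rewrite cross_vert // cross_nil expr0 mul1r.
case/andP=> ne pz.
have [ea|na] := eqVneq a' a.
  subst a'; have nb : b' != b by apply: contraNneq ne => ->.
  rewrite cross_insert_vert // cross_vert //.
  rewrite (eq_delta (g := cross_from a b'
    (fun s t => (-1) ^+ size s * c s (b' :: t)))); last first.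
    by move=> t; rewrite cross_vert.
  rewrite IH // => [|s t ns|s t nt].
  - rewrite -crossN -crossD; apply: cross_ext => s t _ _.
    by rewrite /bidelta delta_sign deltaZ /= mulrBr !mulrDr !mulrN
       !mulrA -expr2 sqrr_sign; ring.
  - by rewrite ca // mulr0.
  - by rewrite cb ?mulr0 //= negb_and nt orbT.
have [eb|nb] := eqVneq b' b.
  subst b'; rewrite cross_insert_horiz // cross_horiz //.
  rewrite (eq_delta (g := cross_from a' b (fun s t => c (a' :: s) t))); last first.
    by move=> t; rewrite cross_horiz.
  rewrite IH // => [|s t ns|s t nt].
  - rewrite -crossN -crossD; apply: cross_ext => s t _ _.
    by rewrite /bidelta /= exprS; ring.
  - by rewrite ca //= negb_and ns orbT.
  - by rewrite cb.
rewrite cross_insert_diag // cross_diag // delta0 ?subr0 // => t.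
by rewrite cross_diag.
Qed.

Definition cross c (z : seq (cart_prod X Y)) : F :=
  if z is (a, b) :: z' then cross_from a b (fun s t => c (a :: s) (b :: t)) z'
  else 0.

(** The differential of the tensor product of two path complexes, in
    coordinates. *)
Definition bibdry c s t : F :=
  delta (c^~ t) s + (-1) ^+ (size s).-1 * delta (c s) t.

Definition bi_walk_of m s t := [&& walk s, walk t & (size s + size t == m.+1)%N].

Definition vanish2 m c := forall s t, ~~ bi_walk_of m s t -> c s t = 0.

Lemma regular_path (V : finType) (a : V) (s : seq V) :
  regular (a :: s) = path (fun i j => i != j) a s.
Proof. by []. Qed.

Lemma vanish2_reg m c s t :
  vanish2 m c -> ~~ (regular s && regular t) -> c s t = 0.
Proof.
move=> c0 nreg; apply: c0; apply: contra nreg.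
by case/and3P=> /andP[_ /walk_regular->] /andP[_ /walk_regular->].
Qed.

Lemma bdry_cross m c z : vanish2 m c -> z != [::] -> regular z ->
  bdry (cross c) z = cross (bibdry c) z.
Proof.
move=> c0; case: z => [//|[a b] z] _ reg; rewrite /bdry reg /=.
have ca s t : ~~ path (fun i j => i != j) a s -> c (a :: s) (b :: t) = 0.
  by move=> n; rewrite (vanish2_reg c0) // !regular_path negb_and n.
have cb s t : ~~ path (fun i j => i != j) b t -> c (a :: s) (b :: t) = 0.
  by move=> n; rewrite (vanish2_reg c0) // !regular_path negb_and n orbT.
rewrite delta_cross //.
rewrite sum_cart.
rewrite (bigD1 a) //= (bigD1 b) //= cross_stay add0r.
rewrite (eq_bigr (fun w => cross_from a b (fun s t =>
   (-1) ^+ size s * c (a :: s) [:: w, b & t]) z)) => [|w wb]; last first.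
  by rewrite cross_vert // eq_sym.
rewrite addrC (eq_bigr (fun v => cross_from a b (fun s t =>
   c [:: v, a & s] (b :: t)) z)) => [|v va]; last first.
  rewrite (bigD1 b) //= big1 ?addr0 => [|w wb].
    by rewrite cross_horiz // eq_sym.
  by rewrite cross_diag // eq_sym.
rewrite -!cross_sum -crossN -!crossD; apply: cross_ext => s t ps pt.
rewrite /bibdry /bidelta /= [X in _ = X - _ + _](bigD1 a) //=.
rewrite (vanish2_reg c0) /= ?eqxx // [X in _ = _ + _ * (X - _)](bigD1 b) //=.
rewrite [X in _ = _ + _ * (X + _ - _)](vanish2_reg c0) /= ?eqxx ?andbF // !add0r.
by rewrite mulrBr mulr_sumr; ring.
Qed.

End Staircase.

(** * Chains of a product graph *)

Lemma walk_step (G : sgraph) (l r : seq G) u p :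
  walk (l ++ [:: u, p & r]) -> adj u p.
Proof.
rewrite /walk; case: l => [|x l] /=; first by case/andP.
by rewrite cat_path /= => /and4P[].
Qed.

Lemma walk_cons (G : sgraph) (x y : G) s :
  walk [:: x, y & s] = adj x y && walk (y :: s).
Proof. by []. Qed.

Section Decomposition.
Variables (F : fieldType) (X Y : sgraph).
Implicit Types (a x : X) (b y : Y) (s : seq X) (t : seq Y).
Implicit Types (w : seq (cart_prod X Y) -> F) (c : seq X -> seq Y -> F).

(** The staircase that makes all its horizontal steps first; its sign is 1, so it
    serves to read off the coefficient of a pair of paths. *)
Definition tail_join a b s t : seq (cart_prod X Y) :=
  [seq (x, b) | x <- s] ++ [seq (last a s, y) | y <- t].

Lemma cross_from_join a b c s t :
  path (fun i j => i != j) a s -> path (fun i j => i != j) b t ->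
  cross_from a b c (tail_join a b s t) = c s t.
Proof.
rewrite /tail_join; elim: s a c => [|a' s IH] a c /=.
  move=> _; elim: t b c => [|b' t IH] b c /=; first by rewrite cross_nil.
  case/andP=> ne pt; rewrite cross_vert; last by rewrite eq_sym.
  by rewrite IH // expr0 mul1r.
case/andP=> ne ps pt; rewrite cross_horiz; last by rewrite eq_sym.
by rewrite IH.
Qed.

Lemma path_tail_join a b s t :
  path (@cart_adj X Y) (a, b) (tail_join a b s t) =
  path (@adj X) a s && path (@adj Y) b t.
Proof.
rewrite /tail_join; elim: s a => [|a' s IH] a /=.
  elim: t b => [//|b' t IH] b /=.
  by rewrite IH /cart_adj /= eqxx adj_irr andbF orbF.
by rewrite IH /cart_adj /= eqxx adj_irr andbF /= andbA.
Qed.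

Lemma neq_path_tail_join a b s t :
  path (fun i j => i != j) (a, b) (tail_join a b s t) =
  path (fun i j => i != j) a s && path (fun i j => i != j) b t.
Proof.
rewrite /tail_join; elim: s a => [|a' s IH] a /=.
  elim: t b => [//|b' t IH] b /=.
  by rewrite IH xpair_eqE eqxx.
by rewrite IH xpair_eqE eqxx andbT andbA.
Qed.

(** The opposite corners of a square have exactly two common neighbours, so the
    local condition on a chain exchanges them at the cost of a sign. *)
Lemma omega_corner m w l a a' b b' r : omega m w -> b != b' ->
  w (l ++ [:: (a, b), (a, b'), (a', b') & r]) =
  - w (l ++ [:: (a, b), (a', b), (a', b') & r]).
Proof.
move=> Ow nb; have w0 := Ow.1.
have nadj (u p q : cart_prod X Y) r' l' :
    ~~ (adj u p && adj p q) -> w (l' ++ [:: u, p, q & r']) = 0.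
  move=> nuv; apply: w0; rewrite /walk_of.
  apply: contra nuv => /andP[wk _]; rewrite (walk_step wk) /=.
  by move: wk; rewrite -cat_rcons => /walk_step.
have [->|na] := eqVneq a a'.
  by rewrite !nadj ?oppr0 //= /cart_adj /= ?eqxx ?adj_irr ?andbF //= ?andbF.
have := @omega_inner F _ m w (a, b) (a', b') l r Ow.
rewrite xpair_eqE negb_and na /= /cart_adj /= (negbTE na) (negbTE nb) /=.
move=> /(_ isT isT); rewrite sum_cart (bigD1 a) //= (bigD1 b') //=.
rewrite [X in _ + X + _]big1 => [|q qb']; last first.
  by rewrite nadj //= /cart_adj /= (negbTE na) (negbTE qb') !andbF.
rewrite addr0 (bigD1 a') //= ?[a' == a]eq_sym // (bigD1 b) //=.
rewrite [X in _ + (_ + X + _)]big1 => [|q qb]; last first.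
  by rewrite nadj //= /cart_adj /= (negbTE na) [b == q]eq_sym (negbTE qb).
rewrite [X in _ + (_ + X)]big1 => [|p /andP[pa pa']]; last first.
  apply: big1 => q _; rewrite nadj //= /cart_adj /=.
  rewrite [a == p]eq_sym (negbTE pa) (negbTE pa') /=.
  by case: eqVneq => //= <-; rewrite (negbTE nb) !andbF.
by rewrite !addr0 => /eqP; rewrite addr_eq0 => /eqP.
Qed.

(** A vertical step is moved behind all the horizontal ones by exchanging one
    corner at a time. *)
Lemma omega_slide m w l a b b' s t : omega m w -> b != b' ->
  w (l ++ [:: (a, b), (a, b') & tail_join a b' s t]) =
  (-1) ^+ size s * w (l ++ (a, b) :: tail_join a b s (b' :: t)).
Proof.
move=> Ow nb; elim: s a l => [|a' s IH] a l.
  by rewrite expr0 mul1r.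
rewrite {1}/tail_join /= (omega_corner l a a' _ Ow nb).
have := IH a' (rcons l (a, b)); rewrite !cat_rcons /= /tail_join /= => ->.
by rewrite exprS; ring.
Qed.

(** Hence the values of [w] on all staircases with given projections are
    determined by one of them. The prefix [l] only serves the induction. *)
Lemma omega_cross_from m w l a b (z : seq (cart_prod X Y)) : omega m w ->
  w (l ++ (a, b) :: z) =
  cross_from a b (fun s t => w (l ++ (a, b) :: tail_join a b s t)) z.
Proof.
move=> Ow; elim: z l a b => [|[a' b'] z IH] l a b; first by rewrite cross_nil.
have w0 : ~~ cart_adj (a, b) (a', b') -> w (l ++ [:: (a, b), (a', b') & z]) = 0.
  move=> nadj; apply: Ow.1; rewrite /walk_of.
  by apply: contra nadj => /andP[/walk_step].
have IH' a0 b0 : w (l ++ [:: (a, b), (a0, b0) & z]) = cross_from a0 b0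
    (fun s t => w (l ++ [:: (a, b), (a0, b0) & tail_join a0 b0 s t])) z.
  by rewrite -cat_rcons IH; apply: cross_ext => s t _ _; rewrite cat_rcons.
have [ea|na] := eqVneq a' a.
  subst a'; have [eb|nb] := eqVneq b' b.
    by subst b'; rewrite cross_stay w0 // /cart_adj !adj_irr !andbF.
  rewrite cross_vert // IH'; apply: cross_ext => s t _ _.
  by rewrite (omega_slide l a s t Ow) // eq_sym.
have [eb|nb] := eqVneq b' b; last first.
  rewrite cross_diag // w0 // /cart_adj /=.
  by rewrite [a == _]eq_sym [b == _]eq_sym (negbTE na) (negbTE nb).
by subst b'; rewrite cross_horiz // IH'.
Qed.

Definition join s t : seq (cart_prod X Y) :=
  if s is a :: s' then if t is b :: t' then (a, b) :: tail_join a b s' t'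
  else [::] else [::].

Definition bicoef w s t : F :=
  if (s != [::]) && (t != [::]) then w (join s t) else 0.

Lemma cross_join c s t : s != [::] -> t != [::] -> regular s -> regular t ->
  cross c (join s t) = c s t.
Proof.
by case: s t => [//|a s] [//|b t] _ _ ps pt; rewrite /= cross_from_join.
Qed.

Lemma walk_join s t : s != [::] -> t != [::] ->
  walk (join s t) = walk s && walk t.
Proof.
by case: s t => [//|a s] [//|b t] _ _; rewrite /walk /= path_tail_join.
Qed.

Lemma regular_join s t : s != [::] -> t != [::] ->
  regular (join s t) = regular s && regular t.
Proof.
by case: s t => [//|a s] [//|b t] _ _; rewrite /regular /= neq_path_tail_join.
Qed.

Lemma size_join s t : s != [::] -> t != [::] ->
  (size (join s t)).+1 = (size s + size t)%N.
Proof.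
case: s t => [//|a s] [//|b t] _ _.
by rewrite /= size_cat !size_map addnS addSn.
Qed.

Lemma omega_bicoef m w : omega m w -> w =1 cross (bicoef w).
Proof.
move=> Ow [|[a b] z] /=; first by rewrite Ow.1.
exact: (omega_cross_from [::] a b z Ow).
Qed.

Lemma bicoef_vanish m w : omega m w -> vanish2 m (bicoef w).
Proof.
move=> Ow s t nst; rewrite /bicoef.
have [sn|//] := boolP (s != [::]); have [tn|//] := boolP (t != [::]).
apply: Ow.1; apply: contra nst; rewrite /walk_of walk_join //.
rewrite /bi_walk_of andbA => /andP[-> /eqP <-] /=.
by rewrite size_join.
Qed.

Lemma bdry_join m w s t : omega m w -> s != [::] -> t != [::] ->
  regular s -> regular t -> bdry w (join s t) = bibdry (bicoef w) s t.
Proof.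
move=> Ow sn tn rs rt.
rewrite (eq_bdry (omega_bicoef Ow)) (bdry_cross (m := m)).
- by rewrite cross_join.
- exact: bicoef_vanish.
- by case: (s) sn => [//|a s']; case: (t) tn.
- by rewrite regular_join // rs.
Qed.

(** The coefficient functions in the tensor product of the two complexes: those
    whose total boundary is again supported on pairs of walks. Together
    [omega_bicoef], [bicoef_omega] and [cross_omega] identify them with the chains
    of the product graph. *)
Definition bi_omega m c := vanish2 m c /\
  forall s t, s != [::] -> t != [::] -> regular s -> regular t ->
    ~~ (walk s && walk t) -> bibdry c s t = 0.

Lemma bicoef_omega m w : omega m w -> bi_omega m (bicoef w).
Proof.
move=> Ow; split; first exact: bicoef_vanish.
move=> s t sn tn rs rt nst; rewrite -(bdry_join Ow) // Ow.2 //.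
by rewrite walk_join.
Qed.

(** A nonzero coefficient of a cross product comes from a staircase, which is a
    walk once its projections are. *)
Lemma cross_neq0 c (z : seq (cart_prod X Y)) : cross c z != 0 ->
  exists s t, [/\ c s t != 0, (s != [::]) && (t != [::]),
    regular s && regular t, (size s + size t = (size z).+1)%N
    & walk s -> walk t -> walk z].
Proof.
case: z => [|[a b] z] /=; first by rewrite eqxx.
rewrite /cross_from mulf_eq0 negb_or => /andP[sg cn].
set s := destutter a _ in cn; set t := destutter b _ in cn.
exists (a :: s), (b :: t).
suff [sz wz] : (size s + size t = size z)%N /\
    (path (@adj X) a s -> path (@adj Y) b t -> path (@cart_adj X Y) (a, b) z).
  split=> //=; first by rewrite /regular /= !destutter_path.
  by rewrite addSn addnS sz.
clear cn; rewrite /s /t {s t}; elim: z a b sg => [//|[a' b'] z IH] a b /=.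
case: (eqVneq a' a) => [->|na]; case: (eqVneq b' b) => [->|nb]; rewrite ?eqxx //.
  rewrite mulf_eq0 negb_or => /andP[_ /IH[sz wz]]; split=> [|ps /=].
    by rewrite /= addnS sz.
  by rewrite /cart_adj /= eqxx => /andP[-> pt]; rewrite wz.
move=> /IH[sz wz]; split=> [|/= /andP[aa ps] pt]; first by rewrite /= addSn sz.
by rewrite /cart_adj /= eqxx aa orbT wz.
Qed.

Lemma cross_omega m c : bi_omega m c -> omega m (cross c).
Proof.
move=> [c0 cb]; split=> z nz; apply: contraNeq nz.
  case/cross_neq0=> s [t [cn _ _ sz wz]].
  have : bi_walk_of m s t by apply: contraNT cn => /c0 ->.
  by case/and3P=> ws wt; rewrite sz /walk_of wz.
have [/andP[zn rz]|nz] := boolP ((z != [::]) && regular z); last first.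
  by rewrite /bdry (negbTE nz) eqxx.
rewrite (bdry_cross c0) // => /cross_neq0[s [t [cn /andP[sn tn] /andP[rs rt] _]]].
have : walk s && walk t by apply: contraNT cn => /cb ->.
by case/andP=> ws wt; apply.
Qed.

End Decomposition.

Section Tensor.
Variables (F : fieldType) (X Y : sgraph).
Implicit Types (e : seq X -> F) (f : seq Y -> F).

Definition tensor e f (s : seq X) (t : seq Y) : F := e s * f t.

(** For a cycle [e] one of the two terms of the product rule vanishes. *)
Lemma bibdry_tensor k m e f s t : cycle_fun k.+1 e -> omega m f ->
  s != [::] -> t != [::] -> regular s -> regular t ->
  bibdry (tensor e f) s t = (-1) ^+ k * tensor e (bdry f) s t.
Proof.
move=> [e0 be] _ sn tn rs rt; rewrite /bibdry /tensor.
have -> : delta (fun s' => e s' * f t) s = 0.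
  rewrite (eq_delta (g := fun s' => f t * e s')) => [|s']; last exact: mulrC.
  by have := be s; rewrite /bdry sn rs /= deltaZ => ->; rewrite mulr0.
rewrite add0r deltaZ /bdry tn rt /=.
have [/andP[_ /eqP ->]|nw] := boolP (walk_of k.+1 s); first by rewrite mulrA.
by rewrite e0 // !mul0r !mulr0.
Qed.

Lemma tensor_bi_omega k m e f : cycle_fun k.+1 e -> omega m f ->
  bi_omega (k + m)%N (tensor e f).
Proof.
move=> Ze Of; split=> [s t nst|s t sn tn rs rt nst].
  rewrite /tensor.
  have [/andP[ws /eqP ss]|ns] := boolP (walk_of k.+1 s); last first.
    by rewrite Ze.1 // mul0r.
  have [/andP[wt /eqP st]|nt] := boolP (walk_of m t); last first.
    by rewrite Of.1 // mulr0.
  by move: nst; rewrite /bi_walk_of ws wt ss st addSn eqxx.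
rewrite (bibdry_tensor Ze Of) // /tensor.
move: nst; rewrite negb_and => /orP[ns|nt].
  by rewrite Ze.1 ?mul0r ?mulr0 // /walk_of (negbTE ns).
by rewrite Of.2 // !mulr0.
Qed.

Lemma omega_cross_tensor k m e f : cycle_fun k.+1 e -> omega m f ->
  omega (k + m)%N (cross (tensor e f)).
Proof. by move=> Ze Of; apply/cross_omega/tensor_bi_omega. Qed.

Lemma cross_eq_reg (c c' : seq X -> seq Y -> F) (z : seq (cart_prod X Y)) :
  (forall s t, s != [::] -> t != [::] -> regular s -> regular t ->
     c s t = c' s t) ->
  cross c z = cross c' z.
Proof.
by case: z => [//|[a b] z] cc /=; apply: cross_ext => s t ps pt; apply: cc.
Qed.

Lemma cross_reg (c : seq X -> seq Y -> F) (z : seq (cart_prod X Y)) :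
  ~~ ((z != [::]) && regular z) -> cross c z = 0.
Proof.
case: z => [//|[a b] z] /=; rewrite /regular /=.
move: (fun s t => c (a :: s) (b :: t)) => d.
elim: z a b d => [//|[a' b'] z IH] a b d /=.
case: (eqVneq a' a) => [->|na]; case: (eqVneq b' b) => [->|nb].
- by rewrite cross_stay.
- move=> nz; rewrite cross_vert // IH //; apply: contra nz => ->.
  by rewrite andbT; apply: contraNneq nb => -[->].
- move=> nz; rewrite cross_horiz // IH //; apply: contra nz => ->.
  by rewrite andbT; apply: contraNneq na => -[->].
- by rewrite cross_diag.
Qed.

Lemma bdry_cross_tensor k m e f (z : seq (cart_prod X Y)) :
  cycle_fun k.+1 e -> omega m f ->
  bdry (cross (tensor e f)) z = (-1) ^+ k * cross (tensor e (bdry f)) z.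
Proof.
move=> Ze Of.
have [/andP[zn rz]|nz] := boolP ((z != [::]) && regular z); last first.
  by rewrite bdry_vanish // cross_reg // mulr0.
rewrite (bdry_cross (m := (k + m)%N)) //; last exact: (tensor_bi_omega Ze Of).1.
rewrite (cross_eq_reg (c' := fun s t => (-1) ^+ k * tensor e (bdry f) s t)).
  by case: (z) => [|[a b] z'] /=; rewrite ?mulr0 // /cross_from mulrCA.
by move=> s t; apply: bibdry_tensor Ze Of.
Qed.

Lemma cycle_cross_tensor k m e f : cycle_fun k.+1 e -> cycle_fun m f ->
  cycle_fun (k + m)%N (cross (tensor e f)).
Proof.
move=> Ze Zf; have Of := cycle_omega Zf.
split=> [|z]; first exact: (omega_cross_tensor Ze Of).1.
rewrite (bdry_cross_tensor _ Ze Of).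
rewrite (cross_eq_reg (c' := fun s t => 0)) => [|s t _ _ _ _].
  by case: z => [|[a b] z] /=; rewrite ?cross0 // mulr0.
by rewrite /tensor Zf.2 mulr0.
Qed.

Lemma cross_tensor_sum (I : Type) (r : seq I) e (q : I -> F)
    (f : I -> seq Y -> F) (z : seq (cart_prod X Y)) :
  cross (tensor e (fun t => \sum_(i <- r) q i * f i t)) z =
  \sum_(i <- r) q i * cross (tensor e (f i)) z.
Proof.
case: z => [|[a b] z] /=; first by rewrite big1 // => i _; rewrite mulr0.
rewrite /cross_from /tensor mulrA mulr_sumr; apply: eq_bigr => i _; ring.
Qed.

Lemma cross_tensorD e f g (z : seq (cart_prod X Y)) :
  cross (tensor e (fun t => f t + g t)) z =
  cross (tensor e f) z + cross (tensor e g) z.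
Proof.
case: z => [|[a b] z] /=; first by rewrite addr0.
by rewrite /cross_from /tensor !mulrDr.
Qed.

End Tensor.

(** * Alternating lists *)

Section Alternating.
Variable T : eqType.
Implicit Types (x y v : T) (s : seq T).

Fixpoint alt x y n : seq T := if n is n'.+1 then x :: alt y x n' else [::].

Definition alternating s :=
  if s is [:: x, y & _] then s == alt x y (size s) else true.

Lemma size_alt x y n : size (alt x y n) = n.
Proof. by elim: n x y => [//|n IH] x y /=; rewrite IH. Qed.

Lemma altSr x y n : alt x y n.+1 = rcons (alt x y n) (if odd n then y else x).
Proof.
elim: n x y => [//|n IH] x y.
by rewrite [LHS]/= -/(alt _ _ n.+1) IH /=; case: odd.
Qed.

Lemma alternating_behead v s : alternating (v :: s) -> alternating s.
Proof. by case: s => [|x [|y s]] //= /eqP[-> es]; rewrite {1}es. Qed.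

Lemma alternating_belast s v : alternating (rcons s v) -> alternating s.
Proof.
case: s => [|x [|y s]] // /eqP; rewrite /= size_rcons => e.
have : rcons [:: x, y & s] v = alt x y (size s).+3 by exact: e.
by rewrite altSr => /rcons_inj/(congr1 fst)/eqP.
Qed.

Lemma alternatingP s :
  (forall l a b d r, s = l ++ [:: a, b, d & r] -> a = d) -> alternating s.
Proof.
case: s => [//|x [//|y s]] /=; elim: s x y => [//|d s IH] x y H /=.
have xd := H [::] x y d s erefl; subst d.
suff /eqP e : [:: y, x & s] == alt y x (size s).+2.
  by apply/eqP; congr (x :: _); exact: e.
by apply: IH => l a b d r e; apply: (H (x :: l)); rewrite /= e.
Qed.

End Alternating.

Section DeltaAlternating.
Variables (F : fieldType) (V : finType).
Implicit Types (f g : seq V -> F) (x y v : V) (s t : seq V).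

(** Inserting a vertex between two distinct neighbours in a list cannot create an
    alternating one, so only insertion at the ends contributes. *)
Lemma delta_alternating_tail g x s :
  (forall t, g t != 0 -> alternating (x :: t)) ->
  path (fun i j => i != j) x s ->
  delta g s = (-1) ^+ size s * \sum_v g (rcons s v).
Proof.
elim: s x g => [|y s IH] x g ga /=; first by rewrite subr0 mul1r.
case/andP=> xy ps; rewrite big1 ?add0r => [|v _].
  rewrite (IH y) // => [|t /ga]; last exact: alternating_behead.
  by rewrite exprS; ring.
apply: contraNeq xy => /ga; rewrite /alternating => /eqP.
by case: (size _) => [|[|[|n]]] // [->].
Qed.

Lemma delta_alternating f x s :
  (forall t, f t != 0 -> alternating t) -> regular (x :: s) ->
  delta f (x :: s) =
  \sum_v f [:: v, x & s] - (-1) ^+ size s * \sum_v f (x :: rcons s v).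
Proof.
move=> fa rs /=; congr (_ - _).
by rewrite (delta_alternating_tail (x := x)) // => t /fa.
Qed.

Lemma regular_alt x y n : x != y -> regular (alt x y n).
Proof.
rewrite /regular; elim: n x y => [//|[//|n] IH] x y xy.
by have /= := IH y x; rewrite eq_sym xy => /(_ isT) ->.
Qed.

Lemma delta_alt f x y n : (forall t, f t != 0 -> alternating t) -> x != y ->
  delta f (alt x y n.+2) =
  f (alt y x n.+3) + (-1) ^+ n * f (alt x y n.+3).
Proof.
move=> fa xy.
rewrite [LHS](delta_alternating fa); last exact: (regular_alt n.+2).
rewrite (bigD1 y) //= big1 => [|v vy]; last first.
  apply: contraNeq vy => /fa; rewrite /alternating /= => /eqP[].
  by move=> ->.
rewrite addr0; congr (_ + _).
rewrite size_alt exprS mulN1r mulNr opprK; congr (_ * _).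
rewrite (bigD1 (if odd n.+2 then y else x)) //= big1 => [|v vy]; last first.
  apply: contraNeq vy => /fa; rewrite /alternating /=.
  rewrite size_rcons size_alt => /eqP e.
  have : rcons (alt x y n.+2) v = alt x y n.+3 by exact: e.
  by rewrite (altSr x y n.+2) => /rcons_inj/(congr1 snd) /= ->.
rewrite addr0; congr (f _).
exact: esym (altSr x y n.+2).
Qed.

End DeltaAlternating.

(** * Contraction of the five-cycle factor *)

Section CycleFactor.
Variables (F : fieldType) (Y : sgraph).
Implicit Types (w : seq (cart_prod C5 Y) -> F) (c : seq C5 -> seq Y -> F).
Implicit Types (s : seq C5) (t : seq Y).

Definition zigzag s := walk s && alternating s.

(** A step that does not turn back has a unique filling, by girth five, and the
    local condition makes its coefficient vanish. *)
Lemma omega_C5_zigzag m (f : seq C5 -> F) s :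
  omega m f -> f s != 0 -> zigzag s.
Proof.
move=> Of fs; have ws s' : f s' != 0 -> walk s'.
  by apply: contraR => nw; rewrite Of.1 // /walk_of (negbTE nw).
rewrite /zigzag ws //; apply: alternatingP => l a b d r es.
apply/eqP; apply: contraNT fs => ad; subst s.
have [//|n0] := eqVneq (f (l ++ [:: a, b, d & r])) 0.
have ab := walk_step (ws _ n0).
have bd : adj b d by move: (ws _ n0); rewrite -cat_rcons => /walk_step.
have [nad _] := C5_two_steps b ad ab bd.
have := omega_inner l r Of ad nad; rewrite (bigD1 b) //= big1 ?addr0.
  by move=> e; rewrite e eqxx in n0.
move=> b' b'b; apply: contraNeq b'b => n0'.
have ab' := walk_step (ws _ n0').
have b'd : adj (b' : C5) d by move: (ws _ n0'); rewrite -cat_rcons => /walk_step.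
by have [_ ->] := C5_two_steps b' ad ab bd.
Qed.

Section ZigzagDelta.
Variable (f : seq C5 -> F).
Hypothesis fz : forall s, ~~ zigzag s -> f s = 0.

Let fa s : f s != 0 -> alternating s.
Proof. by move=> fs; have /andP[] : zigzag s by apply: contraR fs => /fz->. Qed.

Lemma zigzag_behead x y s : zigzag [:: x, y & s] -> zigzag (y :: s).
Proof.
case/andP=> /andP[_ /andP[_ ps]] al.
by rewrite /zigzag (alternating_behead al) andbT.
Qed.

Lemma zigzag_belast x s y : zigzag (x :: rcons s y) -> zigzag (x :: s).
Proof.
case/andP=> /andP[_ pr] al; rewrite /zigzag (@alternating_belast _ (x :: s) y al).
by move: pr; rewrite /walk /= rcons_path => /andP[->].
Qed.

Lemma delta_zigzag_vanish s :
  s != [::] -> regular s -> ~~ zigzag s -> delta f s = 0.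
Proof.
case: s => [//|x s] _ rs nz; rewrite delta_alternating //.
rewrite !big1 ?mulr0 ?subr0 // => v _; apply: fz; apply: contra nz.
  exact: zigzag_belast.
exact: zigzag_behead.
Qed.

Lemma delta_vertex x : delta f [:: x] =
  f [:: prv x; x] + f [:: nxt x; x] - (f [:: x; prv x] + f [:: x; nxt x]).
Proof.
have z2 u v : f [:: u; v] != 0 -> adj u v.
  move=> n0; have /andP[/andP[_]] : zigzag [:: u; v].
    by apply: contraR n0 => /fz->.
  by rewrite /= andbT.
rewrite /= subr0 (sum_nbrs (x := x)) => [|v]; last first.
  by rewrite adj_sym; apply: contraNeq => /z2.
by rewrite (sum_nbrs (x := x)) // => v; apply: contraNeq => /z2.
Qed.

Lemma delta_zigzag x y n : adj x y ->
  delta f (alt x y n.+2) = f (alt y x n.+3) + (-1) ^+ n * f (alt x y n.+3).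
Proof. by move=> xy; rewrite delta_alt // adj_neq. Qed.

End ZigzagDelta.

Section Slices.
Variables (m : nat) (c : seq C5 -> seq Y -> F).
Hypothesis Oc : bi_omega m c.

Lemma bi_omega_walks s t : c s t != 0 ->
  [/\ walk s, walk t & (size s + size t = m.+1)%N].
Proof.
move=> n0; have : bi_walk_of m s t by apply: contraR n0 => /Oc.1 ->.
by case/and3P=> -> -> /eqP.
Qed.

(** At a pair of paths with only one of them a walk, one of the two terms of the
    total boundary vanishes; hence freezing either variable gives chains of the
    other factor. *)
Lemma slice_right s t : t != [::] -> regular t -> ~~ walk t ->
  delta (c s) t = 0.
Proof.
move=> tn rt nt; have [ws|ns] := boolP (walk s); last first.
  by rewrite delta0 // => t'; rewrite Oc.1 // /bi_walk_of (negbTE ns).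
have [sn ps] := andP ws.
have := Oc.2 s t sn tn (walk_regular ps) rt; rewrite ws (negbTE nt) => /(_ isT).
rewrite /bibdry delta0 => [|s']; last first.
  by rewrite Oc.1 // /bi_walk_of (negbTE nt) andbF.
by rewrite add0r => /eqP; rewrite mulf_eq0 signr_eq0 => /eqP.
Qed.

Lemma slice_left t : walk t -> omega (m.+1 - size t) (c^~ t).
Proof.
move=> wt; split=> s ns.
  rewrite Oc.1 //; apply: contra ns => /and3P[ws _ /eqP e].
  by rewrite /walk_of ws -e addnK eqxx.
rewrite /bdry; case: ifP => // /andP[sn rs].
have [tn pt] := andP wt.
have := Oc.2 s t sn tn rs (walk_regular pt); rewrite (negbTE ns) => /(_ isT).
rewrite /bibdry [X in _ + _ * X]delta0 => [|t']; last first.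
  by rewrite Oc.1 // /bi_walk_of (negbTE ns).
by rewrite mulr0 addr0.
Qed.

Lemma slice_zigzag s t : ~~ zigzag s -> c s t = 0.
Proof.
move=> nz; apply: contraNeq nz => n0.
have [_ wt _] := bi_omega_walks n0.
exact: (omega_C5_zigzag (slice_left wt)).
Qed.

(** The net flow through the edge from [x] to its successor: walking an edge back
    and forth is a boundary, so the two orientations count with opposite
    signs. *)
Definition flux x t := c [:: x; nxt x] t - c [:: nxt x; x] t.

(** The projection of the product onto [Y]. *)
Definition push t := \sum_v c [:: v] t.

Lemma delta_vertex_flux x t :
  delta (c^~ t) [:: x] = flux (prv x) t - flux x t.
Proof.
rewrite delta_vertex => [|s]; last exact: slice_zigzag.
by rewrite /flux prvK; ring.
Qed.

Lemma bibdry_push t : \sum_v bibdry c [:: v] t = delta push t.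
Proof.
rewrite /push delta_sum /bibdry big_split /=.
rewrite [X in X + _](eq_bigr _ (fun x _ => delta_vertex_flux x t)).
rewrite (sum_prv (fun x => flux x t)) add0r.
by apply: eq_bigr => v _; rewrite expr0 mul1r.
Qed.

Lemma bibdry_flux x t :
  bibdry c [:: x; nxt x] t - bibdry c [:: nxt x; x] t = - delta (flux x) t.
Proof.
have fz s : ~~ zigzag s -> c^~ t s = 0 by exact: slice_zigzag.
have nx : adj (nxt x) x by rewrite adj_sym adj_nxt.
have := delta_zigzag fz 0 (adj_nxt x); have := delta_zigzag fz 0 nx.
rewrite /bibdry /alt => -> ->; rewrite /flux.
by rewrite deltaB expr0 expr1; ring.
Qed.

Lemma push_omega : omega m push.
Proof.
split=> t nt.
  rewrite /push big1 // => v _; apply: Oc.1; apply: contra nt.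
  by case/and3P=> _ wt; rewrite /walk_of wt /= add1n eqSS.
rewrite /bdry; case: ifP => // /andP[tn rt].
by rewrite /push delta_sum big1 // => v _; rewrite slice_right.
Qed.

End Slices.

Lemma flux_omega m c x : bi_omega m.+1 c -> omega m (flux c x).
Proof.
move=> Oc; split=> t nt.
  rewrite /flux !Oc.1 ?subr0 //; apply: contra nt => /and3P[_ wt];
  by rewrite /walk_of wt /= add2n !eqSS.
rewrite /bdry; case: ifP => // /andP[tn rt].
by rewrite deltaB !(slice_right Oc) // subr0.
Qed.

(** Written in coefficients, the homotopy that contracts the complex of [C5] onto
    the span of the point [o0] and of the fundamental loop. It sends a vertex to
    the path from [o0] to it along the cut cycle, a zigzag that starts backwards
    to the zigzag with one more forward step in front, and a zigzag that starts
    forwards to 0. *)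
Definition contract c s t : F :=
  if s is [:: x, y & r] then
    if y == nxt x then
      if r is d :: _ then if d == x then c (y :: r) t else 0
      else \sum_(v : C5 | (x < v)%N) c [:: v] t
    else 0
  else 0.

Section Contract.
Variables (m : nat) (c : seq C5 -> seq Y -> F).
Hypothesis Oc : bi_omega m c.

Lemma contract_supp s t : contract c s t != 0 ->
  zigzag s /\ bi_walk_of m.+1 s t.
Proof.
case: s => [|x [|y [|d r]]] /=; rewrite ?eqxx //.
  case: (eqVneq y (nxt x)) => [->|_]; last by rewrite eqxx.
  move=> n0.
  have [v] : exists v, c [:: v] t != 0.
    apply/existsP; apply: contraNT n0 => /existsPn n0.
    by rewrite big1 // => v _; apply/eqP; rewrite -[_ == _]negbK n0.
  case/(bi_omega_walks Oc)=> _ wt sz.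
  rewrite /zigzag /bi_walk_of wt walk_cons adj_nxt /= eqxx /=.
  by move: sz; rewrite /= add1n add2n => -[->].
case: (eqVneq y (nxt x)) => [->|_]; last by rewrite eqxx.
case: (eqVneq d x) => [->|_]; last by rewrite eqxx.
move=> n0; have [wy wt sz] := bi_omega_walks Oc n0.
have /andP[_ al] : zigzag [:: nxt x, x & r].
  by apply: contraR n0 => nz; rewrite (slice_zigzag Oc).
split; last first.
  by rewrite /bi_walk_of wt addSn sz eqxx walk_cons adj_nxt wy.
rewrite /zigzag walk_cons adj_nxt wy /=.
by apply/eqP; congr (_ :: _); exact: (eqP al).
Qed.

Lemma contract_slice s t : t != [::] -> regular t -> ~~ walk t ->
  delta (contract c s) t = 0.
Proof.
move=> tn rt nt; case: s => [|x [|y r]]; try by apply: delta0.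
have [ey|ny] := boolP (y == nxt x); last first.
  by apply: delta0 => t'; rewrite /= (negbTE ny).
case: r => [|d r].
  rewrite (eq_delta (g := fun t => \sum_(v : C5 | (x < v)%N) c [:: v] t)).
    by rewrite delta_sum big1 // => v _; rewrite (slice_right Oc).
  by move=> t'; rewrite /= ey.
have [ed|nd] := boolP (d == x); last first.
  by apply: delta0 => t'; rewrite /= (negbTE nd) if_same.
rewrite (eq_delta (g := c [:: y, d & r])) ?(slice_right Oc) // => t'.
by rewrite /= ey ed.
Qed.

Lemma contract_zigzag t s : ~~ zigzag s -> contract c s t = 0.
Proof. by apply: contraNeq => /contract_supp[]. Qed.

Lemma bibdry_contract_vanish s t :
  s != [::] -> t != [::] -> regular s -> regular t -> ~~ (zigzag s && walk t) ->
  bibdry (contract c) s t = 0.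
Proof.
move=> sn tn rs rt; rewrite negb_and /bibdry => /orP[nz|nt].
  rewrite (delta_zigzag_vanish (contract_zigzag t)) // delta0 ?mulr0 ?addr0 //.
  by move=> t'; rewrite contract_zigzag.
rewrite contract_slice // mulr0 addr0 delta0 // => s'.
by apply: contraNeq nt => /contract_supp[_ /and3P[]].
Qed.

Lemma contract_bi_omega : bi_omega m.+1 (contract c).
Proof.
split=> [s t|s t sn tn rs rt nst]; first by apply: contraNeq => /contract_supp[].
apply: bibdry_contract_vanish => //; apply: contra nst.
by case/andP=> /andP[-> _].
Qed.

End Contract.
End CycleFactor.

Section Kunneth.
Variables (F : fieldType) (Y : sgraph).
Implicit Types (c : seq C5 -> seq Y -> F) (s : seq C5) (t : seq Y).

Definition point s : F := (s == [:: o0])%:R.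

Definition loop s : F := if s is [:: x; y] then (y == nxt x)%:R else 0.

Lemma point_cycle : cycle_fun 1 point.
Proof.
split=> s; rewrite /point.
  by case: eqP => [->|//]; rewrite /walk_of /walk.
case: s => [|x s]; [by rewrite bdry_vanish | apply: bdry_size => t].
by case: t => [|a [|b t]] // _; rewrite eqseq_cons andbF.
Qed.

Lemma nxt_nxt_neq (x : C5) : (x == nxt (nxt x)) = false.
Proof.
by apply/negbTE; rewrite -(can_eq prvK) nxtK prv_neq_nxt.
Qed.

Lemma loop_zigzag s : ~~ zigzag s -> loop s = 0.
Proof.
case: s => [//|x [//|y [|//]]]; rewrite /loop.
by case: (y =P nxt x) => // ->; rewrite /zigzag walk_cons adj_nxt /= eqxx.
Qed.

Lemma loop_cycle : cycle_fun 2 loop.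
Proof.
split=> s.
  move=> ns; apply/eqP; apply: contraR ns => n0.
  have : zigzag s by apply: contraR n0 => /loop_zigzag->.
  case: s n0 => [|x [|y [|d s]]]; rewrite /loop ?eqxx // => _ /andP[wk _].
  by rewrite /walk_of wk.
rewrite /bdry; case: ifP => // /andP[sn _].
case: s sn => [//|x [|y s]] _; last first.
  by apply: delta_size => t; case: t => [|a [|b [|d t]]].
rewrite (delta_vertex loop_zigzag) /= prvK !eqxx nxt_nxt_neq.
by rewrite (negbTE (prv_neq_nxt x)); ring.
Qed.

Section Identity.
Variables (m : nat) (c : seq C5 -> seq Y -> F).
Hypothesis Oc : bi_omega m c.
Hypothesis Zc : forall s t, s != [::] -> t != [::] -> regular s -> regular t ->
  bibdry c s t = 0.

Lemma contract_fwd x n t :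
  contract c (alt x (nxt x) n.+3) t = c (alt (nxt x) x n.+2) t.
Proof. by rewrite /= !eqxx. Qed.

Lemma contract_bwd x n t : contract c (alt (nxt x) x n.+2) t = 0.
Proof. by rewrite /= nxt_nxt_neq. Qed.

(** A cycle equals its projection to point and loop plus the boundary of its
    contraction. Each zigzag is checked separately; where the boundary in [Y] of
    [c] appears, it is eliminated by means of the cycle condition at a shorter
    zigzag. *)
Lemma contract_identity s t :
  s != [::] -> t != [::] -> regular s -> regular t ->
  c s t = tensor point (push c) s t + tensor loop (flux c o4) s t +
          bibdry (contract c) s t.
Proof.
move=> sn tn rs rt; rewrite /tensor.
have [zw|nzw] := boolP (zigzag s && walk t); last first.
  rewrite (bibdry_contract_vanish Oc) // addr0.
  move: nzw; rewrite negb_and => /orP[nz|nt].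
    rewrite (slice_zigzag Oc) // loop_zigzag // mul0r addr0 /point.
    by case: eqP nz => [->|_]; rewrite ?mul0r.
  have ct s' : c s' t = 0 by apply: Oc.1; rewrite /bi_walk_of (negbTE nt) andbF.
  by rewrite /push /flux !ct subrr big1 // !mulr0 addr0.
case/andP: zw => /andP[ws al] wt.
have cz := contract_zigzag Oc t.
have dv v : delta (c [:: v]) t = flux c v t - flux c (prv v) t.
  have := Zc (s := [:: v]) isT tn isT rt.
  rewrite /bibdry expr0 mul1r (delta_vertex_flux Oc) => /eqP.
  by rewrite addrC addr_eq0 opprB => /eqP.
have [x [es|[y [n [es xy]]]]] : exists x,
    s = [:: x] \/ exists y n, s = alt x y n.+2 /\ adj x y.
  case: (s) sn ws al => [//|x [|y s']] _; first by exists x; left.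
  rewrite walk_cons => /andP[xy _] al; exists x; right.
  by exists y, (size s'); split=> //; exact: (eqP al).
(* On a vertex the contraction is a sum over tails of the cut cycle, and
   consecutive tails differ by that vertex. *)
- subst s; rewrite /bibdry (delta_vertex cz) [delta (contract c _) t]delta0 //.
  rewrite /point /loop eqseq_cons andbT /contract prvK eqxx nxt_nxt_neq.
  rewrite (negbTE (prv_neq_nxt x)) eqxx mulr0 mul0r !addr0 add0r.
  by rewrite (cut_diff (fun v => c [:: v] t)) -/(push c t); ring.
have [ey|ey] : y = nxt x \/ x = nxt y.
- by move: xy; rewrite adj_C5E => /orP[/eqP|/eqP]; [left | right].
- subst y; have yx : adj (nxt x) x by rewrite adj_sym.
  case: n es => [|n] es.
    (* A forward edge: the cycle condition at the vertices of the tail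
       telescopes to the flow through the edge minus that through the cut. *)
    rewrite es /bibdry (delta_zigzag cz 0 xy) contract_fwd contract_bwd.
    rewrite /alt /point /loop eqseq_cons andbF eqxx mul0r mul1r expr0 mul1r !add0r.
    rewrite (eq_delta (g := fun t => \sum_(v : C5 | (x < v)%N) c [:: v] t)).
      rewrite delta_sum (eq_bigr _ (fun v _ => dv v)) [(size _).-1]/= expr1 mulN1r.
      rewrite -sumrN (eq_bigr _ (fun v _ => opprB _ _)).
      by rewrite (cut_telescope (fun v => flux c v t)) /flux; ring.
    by move=> t'; rewrite /= eqxx.
  (* A longer zigzag starting forwards: the cycle condition is used at the
     zigzag without the first vertex. *)
  rewrite es /bibdry (delta_zigzag cz n.+1 xy) contract_fwd contract_bwd.
  rewrite (eq_delta (g := c (alt (nxt x) x n.+2))) => [|t']; last first.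
    exact: contract_fwd.
  have := Zc (s := alt (nxt x) x n.+2) isT tn (regular_alt _ (adj_neq yx)) rt.
  have fz s' : ~~ zigzag s' -> c^~ t s' = 0 by exact: (slice_zigzag Oc).
  rewrite /bibdry (delta_zigzag fz n yx).
  rewrite !size_alt => /eqP; rewrite -addrA addr_eq0 => /eqP ->.
  have -> : point (alt x (nxt x) n.+3) = 0 by rewrite /point eqseq_cons andbF.
  have -> : loop (alt x (nxt x) n.+3) = 0 by [].
  by rewrite -[n.+3.-1]/(n.+2) -[n.+2.-1]/(n.+1) !exprS; ring.
- subst x; rewrite es /bibdry (delta_zigzag cz n xy) contract_fwd contract_bwd.
  rewrite [delta (contract c _) t]delta0 => [|t']; last exact: contract_bwd.
  have -> : point (alt (nxt y) y n.+2) = 0 by rewrite /point eqseq_cons andbF.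
  have -> : loop (alt (nxt y) y n.+2) = 0.
    by case: n {es} => [|n] //=; rewrite nxt_nxt_neq.
  by ring.
Qed.

End Identity.
End Kunneth.

(** * Betti numbers of the torus *)

Section KunnethStep.
Variables (F : fieldType) (Y : sgraph).
Implicit Types (s : seq C5) (t : seq Y) (z : seq (cart_prod C5 Y)).
Implicit Types (w : seq (cart_prod C5 Y) -> F).

Lemma bibdry_bicoef0 m w s t : cycle_fun m w ->
  s != [::] -> t != [::] -> regular s -> regular t ->
  bibdry (bicoef w) s t = 0.
Proof. by move=> Zw *; rewrite -(bdry_join (cycle_omega Zw)) // Zw.2. Qed.

Lemma push_cycle m w : cycle_fun m w -> cycle_fun m (push (bicoef w)).
Proof.
move=> Zw; have Oc := bicoef_omega (cycle_omega Zw).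
split=> [|t]; first exact: (push_omega Oc).1.
rewrite /bdry; case: ifP => // /andP[tn rt].
by rewrite -(bibdry_push Oc) big1 // => v _; rewrite (bibdry_bicoef0 Zw).
Qed.

Lemma flux_cycle m w x : cycle_fun m.+1 w ->
  cycle_fun m (flux (bicoef w) x).
Proof.
move=> Zw; have Oc := bicoef_omega (cycle_omega Zw).
split=> [|t]; first exact: (flux_omega x Oc).1.
rewrite /bdry; case: ifP => // /andP[tn rt].
apply/eqP; rewrite -oppr_eq0 -(bibdry_flux Oc).
have xn := adj_neq (adj_nxt x).
by rewrite !(bibdry_bicoef0 Zw) ?subrr //= /regular /= ?xn // eq_sym xn.
Qed.

(** Every cycle of the product is homologous to the sum of a cycle of [Y] times
    the point and one, of degree one less, times the loop. *)
Lemma kunneth_span m w : cycle_fun m.+1 w ->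
  exists2 g, omega m.+2 g & forall z,
    w z = cross (tensor (@point F) (push (bicoef w))) z +
          cross (tensor (@loop F) (flux (bicoef w) o4)) z + bdry g z.
Proof.
move=> Zw; have Ow := cycle_omega Zw; have Oc := bicoef_omega Ow.
have Oh := contract_bi_omega Oc.
exists (cross (contract (bicoef w))); first exact: cross_omega.
move=> z; have [/andP[zn rz]|nz] := boolP ((z != [::]) && regular z); last first.
  by rewrite (omega_bicoef Ow) !cross_reg // bdry_vanish // !addr0.
rewrite (bdry_cross Oh.1) // (omega_bicoef Ow).
rewrite (cross_eq_reg z (contract_identity Oc (fun _ _ => bibdry_bicoef0 Zw))).
by case: (z) => [|[a b] z'] /=; rewrite ?addr0 // !crossD.
Qed.

(** Projection and flow are chain maps up to sign, so they turn a bounding chain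
    in the product into bounding chains for the two components. *)
Lemma kunneth_indep m (x y : seq Y -> F) g :
  cycle_fun m.+1 x -> cycle_fun m y -> omega m.+2 g ->
  (forall z, cross (tensor (@point F) x) z + cross (tensor (@loop F) y) z =
             bdry g z) ->
  (exists2 f, omega m.+2 f & forall t, x t = bdry f t) /\
  (exists2 f, omega m.+1 f & forall t, y t = bdry f t).
Proof.
move=> Zx Zy Og e; have Oc := bicoef_omega Og.
have ev s t : s != [::] -> t != [::] -> regular s -> regular t ->
    point F s * x t + loop F s * y t = bibdry (bicoef g) s t.
  by move=> sn tn rs rt; rewrite -(bdry_join Og) // -e !cross_join.
split.
  exists (push (bicoef g)) => [|t]; first exact: push_omega.
  have [/andP[tn rt]|nt] := boolP ((t != [::]) && regular t); last first.
    rewrite bdry_vanish // Zx.1 //; apply: contra nt.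
    by case/andP=> /andP[-> /walk_regular->].
  rewrite /bdry tn rt -(bibdry_push Oc) (bigD1 o0) //= -ev // big1.
    by rewrite /point eqxx /= mul1r mul0r !addr0.
  move=> v v0; rewrite -ev //= /point eqseq_cons (negbTE v0) !mul0r addr0 //.
exists (fun t => -1 * flux (bicoef g) o4 t) => [|t].
  exact/omegaZ/flux_omega.
have [/andP[tn rt]|nt] := boolP ((t != [::]) && regular t); last first.
  rewrite bdry_vanish // Zy.1 //; apply: contra nt.
  by case/andP=> /andP[-> /walk_regular->].
rewrite bdryZ /bdry tn rt mulN1r -(bibdry_flux Oc).
by rewrite -!ev // /point /loop !eqseq_cons !andbF eqxx nxt_nxt_neq /=; ring.
Qed.

End KunnethStep.

Section HomologyBasis.
Variables (F : fieldType).

(** Coordinates on homology are expressed through representatives, which avoids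
    quotients until the very end and keeps the induction elementary. *)
Definition homology_basis (G : sgraph) (m : nat) (I : finType)
    (b : I -> seq G -> F) :=
  [/\ forall i, cycle_fun m (b i),
      forall u, cycle_fun m u -> exists (q : I -> F) (g : seq G -> F),
        omega m.+1 g /\ forall s, u s = \sum_i q i * b i s + bdry g s
    & forall (q : I -> F) g, omega m.+1 g ->
        (forall s, \sum_i q i * b i s = bdry g s) -> forall i, q i = 0].

Definition has_betti (G : sgraph) (m k : nat) :=
  exists (I : finType) (b : I -> seq G -> F), #|I| = k /\ homology_basis m b.

Lemma omega0 (G : sgraph) m : omega m (fun _ : seq G => 0 : F).
Proof. by split=> s _ //; rewrite /bdry delta0 // if_same. Qed.

Lemma bdry0 (G : sgraph) (s : seq G) : bdry (fun=> 0 : F) s = 0.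
Proof. by rewrite /bdry delta0 // if_same. Qed.

Lemma has_betti_trivial (G : sgraph) m :
  (forall (u : seq G -> F) s, cycle_fun m u -> u s = 0) -> has_betti G m 0.
Proof.
move=> u0; exists void, (fun _ _ => 0).
split; first by rewrite card_void.
split=> [[]|u Zu|q g _ _ []].
exists (fun=> 0), (fun=> 0); split; first exact: omega0.
by move=> s; rewrite u0 // bdry0 big1 ?addr0 // => -[].
Qed.

Lemma has_betti_size0 (G : sgraph) : has_betti G 0 0.
Proof.
by apply: has_betti_trivial => u [|x s] [u0 _]; apply: u0; rewrite /walk_of ?andbF.
Qed.

(** The Kuenneth formula for [C5], whose own Betti numbers are 1 and 1. *)
Lemma has_betti_C5_prod (Y : sgraph) m k k' :
  has_betti Y m.+1 k -> has_betti Y m k' ->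
  has_betti (cart_prod C5 Y) m.+1 (k + k')%N.
Proof.
move=> [I [x [cI [Zx Sx Ix]]]] [J [y [cJ [Zy Sy Iy]]]].
pose b (i : I + J) : seq (cart_prod C5 Y) -> F := match i with
  | inl i => cross (tensor (@point F) (x i))
  | inr j => cross (tensor (@loop F) (y j)) end.
have bE (q : I + J -> F) z : \sum_i q i * b i z =
    cross (tensor (@point F) (fun t => \sum_i q (inl i) * x i t)) z +
    cross (tensor (@loop F) (fun t => \sum_j q (inr j) * y j t)) z.
  by rewrite big_sumType /= !cross_tensor_sum.
exists (I + J)%type, b; split; first by rewrite card_sum cI cJ.
split=> [[i|j]|u Zu|q g Og e].
- exact: (cycle_cross_tensor (point_cycle F) (Zx i)).
- exact: (cycle_cross_tensor (loop_cycle F) (Zy j)).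
- have [g Og ug] := kunneth_span Zu.
  have [q1 [g1 [Og1 e1]]] := Sx _ (push_cycle Zu).
  have [q2 [g2 [Og2 e2]]] := Sy _ (flux_cycle o4 Zu).
  have O1 := omega_cross_tensor (point_cycle F) Og1.
  have O2 := omega_cross_tensor (loop_cycle F) Og2.
  exists (fun i => match i with inl i => q1 i | inr j => q2 j end).
  exists (fun z => g z + (cross (tensor (@point F) g1) z +
                          -1 * cross (tensor (@loop F) g2) z)).
  split; first by apply: omegaD => //; apply: omegaD => //; apply: omegaZ.
  move=> z; rewrite bE !bdryD bdryZ ug.
  rewrite (bdry_cross_tensor z (point_cycle F) Og1).
  rewrite (bdry_cross_tensor z (loop_cycle F) Og2).
  rewrite (cross_eq_reg (c' := tensor (@point F) (fun t =>
    \sum_i q1 i * x i t + bdry g1 t))); last by move=> *; rewrite /tensor e1.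
  rewrite [X in _ + X + _](cross_eq_reg (c' := tensor (@loop F) (fun t =>
    \sum_j q2 j * y j t + bdry g2 t))); last by move=> *; rewrite /tensor e2.
  by rewrite !cross_tensorD; ring.
have lin (K : finType) n (f : K -> seq Y -> F) (p : K -> F) :
    (forall i, cycle_fun n (f i)) -> cycle_fun n (fun t => \sum_i p i * f i t).
  move=> Zf; split=> [t nt|t]; first by rewrite big1 // => i _; rewrite (Zf i).1 ?mulr0.
  by rewrite bdry_sum big1 // => i _; rewrite (Zf i).2 mulr0.
have [[f Of ef] [f' Of' ef']] := kunneth_indep (lin _ _ _ (q \o inl) Zx)
  (lin _ _ _ (q \o inr) Zy) Og (fun z => etrans (esym (bE q z)) (e z)).
by case=> [i|j]; [apply: (Ix (q \o inl) f) | apply: (Iy (q \o inr) f')].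
Qed.

Lemma has_betti_K1_1 : has_betti K1 1 1.
Proof.
exists unit, (fun _ s => (s == [:: tt])%:R); split; first by rewrite card_unit.
have u0 (u : seq K1 -> F) m : vanish_off (walk_of m.+2) u -> forall s, u s = 0.
  move=> uv s; apply: uv; rewrite /walk_of.
  by case: s => [|x [|y s]] //; rewrite walk_cons.
split=> [_|u Zu|q g Og e []].
- split=> [[|[] [|y s]]|s] //=; rewrite ?eqseq_cons ?andbF //.
  case: s => [|x s]; [by rewrite bdry_vanish | apply: bdry_size => t].
  by case: t => [|a [|d t]] // _; rewrite eqseq_cons andbF.
- exists (fun _ => u [:: tt]), (fun=> 0); split; first exact: omega0.
  move=> s; rewrite bdry0 addr0 (big_pred1 tt) => [|[]//].
  case: eqP => [->|ns]; first by rewrite mulr1.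
  rewrite mulr0 Zu.1 //; apply/negP; rewrite /walk_of.
  by case: s ns => [|[] [|y s]] //=; rewrite andbF.
have := e [:: tt]; rewrite (big_pred1 tt) => [|[]//]; rewrite eqxx mulr1 => ->.
by apply: bdry_size => t _; apply: (u0 _ _ Og.1).
Qed.

Lemma has_betti_K1_0 m : has_betti K1 m.+2 0.
Proof.
apply: has_betti_trivial => u s [uv _]; apply: uv; rewrite /walk_of.
by case: s => [|x [|y s]] //; rewrite walk_cons.
Qed.

End HomologyBasis.

Section Relabelling.
Variables (F : fieldType) (G H : sgraph) (phi : G -> H) (psi : H -> G).
Hypotheses (phiK : cancel phi psi) (psiK : cancel psi phi).
Hypothesis phi_adj : forall x y, adj (phi x) (phi y) = adj x y.

Lemma walk_map s : walk (map phi s) = walk s.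
Proof.
rewrite /walk sorted_map; congr (_ && _); first by case: s.
by apply: eq_sorted => x y; rewrite /= phi_adj.
Qed.

Lemma walk_of_map m s : walk_of m (map phi s) = walk_of m s.
Proof. by rewrite /walk_of walk_map size_map. Qed.

Lemma regular_map s : regular (map phi s) = regular s.
Proof.
rewrite /regular sorted_map; apply: eq_sorted => x y /=.
by rewrite (can_eq phiK).
Qed.

Lemma delta_map (f : seq H -> F) s :
  delta f (map phi s) = delta (fun s' => f (map phi s')) s.
Proof.
have sum_map (g : H -> F) : \sum_v g v = \sum_v g (phi v).
  by rewrite (reindex phi) //; exists psi => v _; rewrite ?phiK ?psiK.
elim: s f => [|x s IH] f /=; first by rewrite sum_map.
by rewrite sum_map IH.
Qed.

Lemma bdry_map (f : seq H -> F) s :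
  bdry f (map phi s) = bdry (fun s' => f (map phi s')) s.
Proof. by rewrite /bdry delta_map regular_map; case: s. Qed.

Lemma omega_map m (f : seq H -> F) :
  omega m f -> omega m (fun s => f (map phi s)).
Proof.
move=> [f1 f2]; split=> s ns; first by rewrite f1 // walk_of_map.
by rewrite -bdry_map f2 // walk_map.
Qed.

Lemma cycle_map m (f : seq H -> F) :
  cycle_fun m f -> cycle_fun m (fun s => f (map phi s)).
Proof.
move=> [f1 f2]; split=> s; first by move=> ns; rewrite f1 // walk_of_map.
by rewrite -bdry_map f2.
Qed.

End Relabelling.

Lemma has_betti_iso (F : fieldType) (G H : sgraph) (phi : G -> H)
    (psi : H -> G) m k :
  cancel phi psi -> cancel psi phi ->
  (forall x y, adj (phi x) (phi y) = adj x y) ->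
  has_betti F H m k -> has_betti F G m k.
Proof.
move=> phiK psiK phi_adj [I [b [cI [Zb Sb Ib]]]].
have psi_adj x y : adj (psi x) (psi y) = adj x y by rewrite -phi_adj !psiK.
exists I, (fun i s => b i (map phi s)); split=> //.
split=> [i|u Zu|q g Og e].
- exact: (cycle_map phiK psiK).
- have [q [g [Og e]]] := Sb _ (cycle_map psiK phiK psi_adj Zu).
  exists q, (fun s => g (map phi s)); split; first exact: (omega_map phiK psiK).
  by move=> s; rewrite -(bdry_map phiK psiK) -e mapK.
apply: (Ib q _ (omega_map psiK phiK psi_adj Og)) => s.
by rewrite -(bdry_map psiK phiK) -e; apply: eq_bigr => i _; rewrite mapK.
Qed.

(** Pascal's rule. The induction starts from [K1], and [C5] itself is reached
    through the isomorphic graph [cart_prod C5 K1]. *)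
Lemma has_betti_torus (F : fieldType) r m :
  has_betti F (cart_power C5 r) m.+1 'C(r, m).
Proof.
have base n : has_betti F K1 n.+1 'C(0, n).
  by case: n => [|n]; [exact: has_betti_K1_1 | exact: has_betti_K1_0].
have step Y n k : (forall j, has_betti F Y j.+1 'C(k, j)) ->
    has_betti F (cart_prod C5 Y) n.+1 'C(k.+1, n).
  move=> bY; case: n => [|n]; last by rewrite binS; apply: has_betti_C5_prod.
  have := has_betti_C5_prod (bY 0%N) (has_betti_size0 F Y).
  by rewrite !bin0.
elim: r m => [|[|r] IH] m; [exact: base | | exact: step].
apply: (@has_betti_iso F C5 (cart_prod C5 K1) (fun x => (x, tt)) fst).
- by [].
- by case=> x [].
- by move=> x y; rewrite /= /cart_adj /= andbF.
exact: step.
Qed.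

(** * From functions on lists to path homology *)

Section Coordinates.
Variables (F : fieldType) (G : sgraph).
Implicit Types (f : seq G -> F) (s : seq G).

Definition coef_fun p (u : rchain F G p) s : F :=
  \sum_(t : rpath G p | val (val t) == s) u t.

Definition chain_of p f : rchain F G p := [ffun t => f (val (val t))].

Lemma coef_fun_val p (u : rchain F G p) (t : rpath G p) :
  coef_fun u (val (val t)) = u t.
Proof.
by rewrite /coef_fun (big_pred1 t).
Qed.

Lemma coef_fun_out p (u : rchain F G p) s :
  ~~ (regular s && (size s == p.+1)) -> coef_fun u s = 0.
Proof.
move=> ns; apply: big_pred0 => t; apply: contraNF ns => /eqP <-.
by rewrite (valP t) size_tuple eqxx.
Qed.

Lemma rpathP p s : regular s -> size s == p.+1 ->
  exists t : rpath G p, val (val t) = s.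
Proof.
move=> rs ss; have rt : regular (Tuple ss) by [].
by exists (exist _ (Tuple ss) rt).
Qed.

Lemma coef_fun_ext p (u : rchain F G p) f :
  (forall s, ~~ (regular s && (size s == p.+1)) -> f s = 0) ->
  (forall t : rpath G p, u t = f (val (val t))) -> coef_fun u =1 f.
Proof.
move=> f0 uf s; have [/andP[rs ss]|ns] := boolP (regular s && (size s == p.+1)).
  by have [t <-] := rpathP rs ss; rewrite coef_fun_val uf.
by rewrite f0 // coef_fun_out.
Qed.

Lemma face_insert p (s : p.+2.-tuple G) (t : p.+1.-tuple G) (q : 'I_p.+2) v :
  (val s == take q t ++ v :: drop q t) = (face s q == t) && (tnth s q == v).
Proof.
have qt : (q <= size t)%N by rewrite size_tuple -ltnS.
have sz : size (take q t ++ v :: drop q t) = p.+2.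
  by rewrite size_cat /= addnS -size_cat cat_take_drop size_tuple.
apply/eqP/andP => [es|[/eqP et /eqP ev]].
  split; last first.
    by rewrite (tnth_nth v) es nth_cat size_takel // ltnn subnn.
  apply/eqP/eq_from_tnth => j; rewrite tnth_mktuple !(tnth_nth v) es nth_cat.
  rewrite size_takel // /= /bump; case: (leqP q j) => qj.
    rewrite add1n ltnNge (leq_trans qj) //= subSn //= nth_drop subnKC //.
  by rewrite add0n qj nth_take.
apply: (@eq_from_nth _ v); rewrite ?sz ?size_tuple // => i ip.
rewrite nth_cat size_takel //.
pose io := Ordinal ip; rewrite -(tnth_nth v s io).
have [e|ne] := eqVneq q io.
  by rewrite -e ev e ltnn subnn.
have [j ej] := unlift_some ne; move=> _.
have -> : tnth s io = tnth t j by rewrite -et tnth_mktuple -ej.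
have ei : i = bump q j by rewrite -[i]/(nat_of_ord io) ej.
rewrite (tnth_nth v) ei /bump; case: (leqP q j) => qj.
  by rewrite add1n ltnNge (leq_trans qj) //= subSn //= nth_drop subnKC.
by rewrite add0n qj nth_take.
Qed.

(** Insertions at a position [q] correspond to the paths whose [q]-th face is
    given. *)
Lemma coef_bd p (u : rchain F G p.+1) :
  coef_fun (bd F G p.+1 u) =1 bdry (coef_fun u).
Proof.
apply: coef_fun_ext => [s ns|t].
  have [sz|sz] := eqVneq (size s) p.+1; last first.
    apply: bdry_size => t st; apply: coef_fun_out.
    by rewrite st eqSS (negbTE sz) andbF.
  apply: bdry_vanish; apply: contra ns => /andP[_ ->].
  by rewrite sz eqxx.
rewrite /bdry (valP t) andbT.
have -> : tval (val t) != [::] by rewrite -size_eq0 size_tuple.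
rewrite delta_insert /bd lfunE /= /bdS_fun sum_ffunE.
rewrite (eq_bigr (fun s : rpath G p.+1 => \sum_(q < p.+2)
  (-1) ^+ q * (u s * (face (val s) q == val t)%:R))) => [|s _]; last first.
  rewrite !ffunE sum_ffunE scaler_sumr; apply: eq_bigr => q _.
  by rewrite !ffunE /= eq_sym /GRing.scale /= mulrCA.
rewrite exchange_big size_tuple /=; apply: eq_bigr => q _.
rewrite -mulr_sumr; congr (_ * _).
rewrite /coef_fun [RHS](exchange_big_dep predT) //=; apply: eq_bigr => s _.
rewrite (eq_bigl (fun v => (face (val s) q == val t) && (tnth (val s) q == v))).
  case: eqP => _; last by rewrite big_pred0 ?mulr0.
  by rewrite (big_pred1 (tnth (val s) q)) ?mulr1 // => v; rewrite eq_sym.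
by move=> v; rewrite face_insert.
Qed.

End Coordinates.

Section Spaces.
Variables (F : fieldType) (G : sgraph).

Lemma mem_allowed p (u : rchain F G p) :
  u \in allowed F (@adj G) p <-> vanish_off (@walk G) (coef_fun u).
Proof.
split=> [/coord_span -> s ns|u0].
  rewrite /coef_fun big1 // => t /eqP ts; rewrite sum_ffunE big1 // => i _.
  rewrite ffunE.
  have /fintype.imageP[t' at' et'] :
      [seq elem F (val s) | s in @allowed_path G (@adj G) p]`_i \in
      [seq elem F (val s) | s in @allowed_path G (@adj G) p].
    by apply: mem_nth; rewrite size_image.
  rewrite et' ffunE.
  case: eqP => [e|_]; last by rewrite scaler0.
  move: ns; rewrite -ts e /walk -size_eq0 size_tuple /=.
  by rewrite (_ : sorted _ _ = true) //; apply: at'.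
have -> : u = \sum_t u t *: elem F (val t).
  apply/ffunP => t; rewrite sum_ffunE (bigD1 t) //= big1 ?addr0.
    by rewrite !ffunE eqxx /GRing.scale /= mulr1.
  move=> t' t't; rewrite !ffunE.
  by rewrite (inj_eq val_inj) eq_sym (negbTE t't) /GRing.scale /= mulr0.
apply: rpred_sum => t _; have [at_|nat_] := boolP (sorted (@adj G) (val t)).
  apply/rpredZ/memv_span/fintype.imageP; by exists t.
rewrite -(coef_fun_val u t) u0 ?scale0r ?rpred0 //.
by rewrite /walk (negbTE nat_) andbF.
Qed.

Lemma bdry_size0 (f : seq G -> F) s :
  vanish_off (walk_of 1) f -> bdry f s = 0.
Proof.
move=> f0; have [->|sn] := eqVneq s [::]; first exact: bdry_vanish.
apply: bdry_size => t st; apply: f0.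
by rewrite /walk_of st eqSS size_eq0 (negbTE sn) andbF.
Qed.

Lemma mem_Omega p (u : rchain F G p) :
  u \in Omega F (@adj G) p <-> omega p.+1 (coef_fun u).
Proof.
have coef_out : vanish_off (walk_of p.+1) (coef_fun u) <->
                vanish_off (@walk G) (coef_fun u).
  split=> u0 s ns; first by apply: u0; rewrite /walk_of (negbTE ns).
  have [ws|nws] := boolP (walk s); last exact: u0.
  apply: coef_fun_out; apply: contra ns => /andP[_ sz].
  by rewrite /walk_of ws.
rewrite /Omega memv_cap -memv_preim; case: p u coef_out => [|p] u coef_out.
  rewrite /bd lfunE /= mem0v andbT; split=> [/mem_allowed/coef_out u0|].
    by split=> // s _; apply: bdry_size0.
  by case=> /coef_out/mem_allowed.
split=> [/andP[/mem_allowed/coef_out u0 /mem_allowed b0]|[]].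
  by split=> // s ns; rewrite -coef_bd b0.
move=> /coef_out/mem_allowed u0 b0; rewrite u0; apply/mem_allowed => s ns.
by rewrite coef_bd b0.
Qed.

Lemma coef_fun_inj p (u v : rchain F G p) : coef_fun u =1 coef_fun v -> u = v.
Proof. by move=> uv; apply/ffunP => t; rewrite -!coef_fun_val uv. Qed.

Lemma coef_fun0 p : coef_fun (0 : rchain F G p) =1 fun=> 0.
Proof. by move=> s; rewrite /coef_fun big1 // => t _; rewrite ffunE. Qed.

Lemma mem_cycles p (u : rchain F G p) :
  u \in cycles F (@adj G) p <-> cycle_fun p.+1 (coef_fun u).
Proof.
rewrite /cycles memv_cap memv_ker; split.
  case/andP=> /mem_Omega Ou b0; split=> [|s]; first exact: Ou.1.
  case: p u Ou b0 => [|p] u Ou /eqP b0; first exact: bdry_size0 Ou.1.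
  by rewrite -coef_bd b0 coef_fun0.
move=> Zu; apply/andP; split; first exact/mem_Omega/cycle_omega.
case: p u Zu => [|p] u Zu; first by rewrite /bd lfunE.
by apply/eqP/coef_fun_inj => s; rewrite coef_bd coef_fun0 Zu.2.
Qed.

Lemma coef_chain_of p m (f : seq G -> F) : m = p.+1 ->
  vanish_off (walk_of m) f -> coef_fun (chain_of p f) =1 f.
Proof.
move=> -> f0; apply: coef_fun_ext => [s ns|t]; last by rewrite ffunE.
apply: f0; apply: contra ns => /andP[/andP[_ /walk_regular->] ->] //.
Qed.

Lemma mem_boundaries p (u : rchain F G p) :
  u \in boundaries F (@adj G) p <->
  exists2 g, omega p.+2 g & forall s, coef_fun u s = bdry g s.
Proof.
split=> [/memv_imgP[v /mem_Omega Ov ->]|[g Og ug]].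
  by exists (coef_fun v) => // s; rewrite coef_bd.
have gE := coef_chain_of erefl Og.1; apply/memv_imgP; exists (chain_of p.+1 g).
  by apply/mem_Omega; apply: eq_omega Og => s; rewrite gE.
by apply: coef_fun_inj => s; rewrite coef_bd ug; apply: eq_bdry => t; rewrite gE.
Qed.

Lemma coef_fun_sum p (I : finType) (q : I -> F) (z : I -> rchain F G p) s :
  coef_fun (\sum_i q i *: z i) s = \sum_i q i * coef_fun (z i) s.
Proof.
rewrite /coef_fun; under eq_bigr do rewrite sum_ffunE.
rewrite exchange_big; apply: eq_bigr => i _; rewrite mulr_sumr.
by apply: eq_bigr => t _; rewrite ffunE.
Qed.

End Spaces.

Section QuotientBasis.
Variables (F : fieldType) (vT : vectType F) (Z B : {vspace vT}).
Local Open Scope quotient_scope.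

Lemma pi_quotv_eq (u v : subvs_of Z) :
  (\pi_(quotv Z B) u = \pi_(quotv Z B) v) <-> (vsval u - vsval v \in B).
Proof.
split=> [/eqP|uv].
  by rewrite -Quotient.idealrBE inE raddfB.
by apply/eqP; rewrite -Quotient.idealrBE inE raddfB.
Qed.

(** A basis of [Z] modulo [B] gives a linear bijection from the coordinate space
    onto the quotient; the isomorphism asked for is its inverse. *)
Lemma quotv_iso (I : finType) (z : I -> vT) :
  (forall i, z i \in Z) ->
  (forall u, u \in Z -> exists q : I -> F, u - \sum_i q i *: z i \in B) ->
  (forall q : I -> F, \sum_i q i *: z i \in B -> forall i, q i = 0) ->
  lmod_iso (quotv Z B) 'rV[F]_#|I|.
Proof.
move=> zZ zspan zfree.
pose comb (r : 'rV[F]_#|I|) : subvs_of Z :=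
  \sum_i r 0 (enum_rank i) *: Subvs (zZ i).
pose g r : quotv Z B := \pi_(quotv Z B) (comb r).
have combE r : vsval (comb r) = \sum_i r 0 (enum_rank i) *: z i.
  by rewrite raddf_sum; apply: eq_bigr => i _; exact: linearZ.
have glin : linear g.
  move=> a r r'.
  have -> : a *: g r = \pi_(quotv Z B) (a *: comb r) by exact: pi_quotv_scale.
  rewrite /g -pi_quotvD; congr (\pi_(quotv Z B) _).
  rewrite scaler_sumr -big_split; apply: eq_bigr => i _.
  by rewrite !mxE scalerDl scalerA.
have ginj : injective g.
  move=> r r' /pi_quotv_eq; rewrite !combE -sumrB => dB.
  apply/rowP => j; rewrite -[j]enum_valK; set i := enum_val j.
  apply/eqP; rewrite -subr_eq0; apply/eqP.
  apply: (zfree (fun i => r 0 (enum_rank i) - r' 0 (enum_rank i))).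
  by under eq_bigr do rewrite scalerBl.
have gsurj h : exists r, g r = h.
  have [q uq] := zspan _ (subvsP (repr h)).
  exists (\row_j q (enum_val j)); rewrite -[h]reprK; apply/pi_quotv_eq.
  rewrite combE -opprB rpredN; under [X in _ - X]eq_bigr do rewrite mxE enum_rankK.
  exact: uq.
pose f h := sval (cid (gsurj h)).
have fK : cancel f g by move=> h; rewrite /f; case: cid.
have gK : cancel g f by move=> r; apply: ginj; rewrite fK.
have flin : linear f by move=> a h h'; apply: ginj; rewrite glin !fK.
pose L := GRing.isLinear.Build F (quotv Z B) 'rV[F]_#|I| _ f flin.
pose fL : {linear quotv Z B -> 'rV[F]_#|I|} := HB.pack f L.
by exists fL; exists g.
Qed.

End QuotientBasis.

Lemma GLMY_graph_iso (F : fieldType) (G : sgraph) p k :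
  has_betti F G p.+1 k -> lmod_iso (GLMY_graph F G p) 'rV[F]_k.
Proof.
move=> [I [b [<- [Zb Sb Ib]]]].
have bE i := coef_chain_of erefl (Zb i).1.
have sumE (q : I -> F) s :
    coef_fun (\sum_i q i *: chain_of p (b i)) s = \sum_i q i * b i s.
  by rewrite coef_fun_sum; apply: eq_bigr => i _; rewrite bE.
apply: (@quotv_iso _ _ _ _ I (fun i => chain_of p (b i))) => [i|u /mem_cycles Zu|q].
- apply/mem_cycles; split=> s; first by move=> ns; rewrite bE (Zb i).1.
  by rewrite (eq_bdry (bE i)) (Zb i).2.
- have [q [g [Og ug]]] := Sb _ Zu; exists q; apply/mem_boundaries.
  exists g => // s.
  have -> : u - \sum_i q i *: chain_of p (b i) =
     \sum_(j : bool) (if j then 1 else -1) *: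
        (if j then u else \sum_i q i *: chain_of p (b i)).
    by rewrite big_bool /= scale1r scaleN1r.
  by rewrite coef_fun_sum big_bool /= mul1r mulN1r sumE ug; ring.
move=> /mem_boundaries[g Og e]; apply: (Ib q g Og) => s.
by rewrite -e sumE.
Qed.

(** * Size, curvature and homology of the torus *)

Theorem theorem5p2 (r : nat) (hr : (1 <= r)%N) :
  [/\ #|cart_power C5 r| = (5 ^ r)%N /\
        (forall x : cart_power C5 r, degree x = (2 * r)%N),
      forall (R : realType) (x y : cart_power C5 r),
        adj x y -> has_LLY_curvature x y (1 / (2 * r)%:R : R)
    & forall (F : fieldType) (p : nat),
        ((p <= r)%N ->
           lmod_iso (GLMY_graph F (cart_power C5 r) p) 'rV[F]_('C(r, p))) /\
        ((r < p)%N ->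
           forall h : GLMY_graph F (cart_power C5 r) p, h = 0)].
Proof.
split.
- by split; [exact: card_torus | exact: degree_torus].
- move=> R x y /torus_shift_edge[tau [tau' [f sh]]].
  by apply: shift_curvature sh _; [exact: degree_torus | rewrite muln_gt0].
move=> F p; have iso := GLMY_graph_iso (has_betti_torus F r p).
split=> [//|rp h]; move: iso; rewrite bin_small // => -[f [g fK _]].
by apply: (can_inj fK); rewrite linear0 thinmx0.
Qed.
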